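(* Let $f:\Delta\to\Delta$ be a quasiconformal self homeomorphism of the unit disk $\Delta$. Then $f$ maps every $\rho$-Bloch subdomain of $\Delta$ onto a $\rho$-Bloch subdomain of $\Delta$; that is, if $X$ is a $\rho$-Bloch subdomain of $\Delta$, then $f(X)$ is a $\rho$-Bloch subdomain of $\Delta$.
   Context: $\Delta=\{z\in\mathbb{C}:|z|<1\}$. A subdomain of $\Delta$ is a nonempty connected open subset of $\Delta$ (possibly $\Delta$ itself). $\rho$ denotes the Poincaré (hyperbolic) metric on $\Delta$ with density $\rho(z)=\frac{1}{1-|z|^2}$, and $\rho(\cdot,\cdot)$ also denotes the associated distance. For a subdomain $X$ of $\Delta$, let $R(X,\Delta)$ be the supremum of all radii (measured with respect to $\rho$) of hyperbolic disks $\{z\in\Delta:\rho(z,p)<r\}$ that are contained in $X$. $X$ is a $\rho$-Bloch subdomain of $\Delta$ if $R(X,\Delta)<\infty$. A quasiconformal self homeomorphism of $\Delta$ is a homeomorphism of $\Delta$ onto $\Delta$ that is $K$-quasiconformal for some finite $K\geq 1$. *)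

(* Defs.v *)
From HB Require Import structures.
From mathcomp Require Import all_boot all_order all_algebra.
From mathcomp Require Import all_classical all_reals all_analysis.
From mathcomp Require Import measurable_realfun.

Set Implicit Arguments.
Unset Strict Implicit.
Unset Printing Implicit Defensive.
Import Order.TTheory GRing.Theory Num.Theory.
Import numFieldNormedType.Exports.

Local Open Scope classical_set_scope.
Local Open Scope ring_scope.

(* The complex plane is R * R, with its product topology, product (= Borel)
   sigma-algebra and product Lebesgue measure. The library norm on R * R is the
   sup norm, hence the separate modulus. *)

Definition cmod {R : realType} (z : R * R) : R :=
  Num.sqrt (z.1 ^+ 2 + z.2 ^+ 2).

Definition unit_disk {R : realType} : set (R * R) := [set z | cmod z < 1].

(* A curve is (the restriction to [0, 1] of) a function R -> R * R; none of the
   notions below depends on its values outside [0, 1]. *)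
Definition curve_in {R : realType} (D : set (R * R)) (c : R -> R * R) : Prop :=
  {within `[0, 1], continuous c} /\ c @` `[0, 1] `<=` D.

(* Same shape as [variation] of numfun, with [cmod] in place of `|.|. *)
Definition polygonal_length {R : realType} (a b : R) (c : R -> R * R)
    (s : seq R) : R :=
  let F := c \o nth b (a :: s) in
  \sum_(0 <= n < size s) cmod (F n.+1 - F n).

Definition arc_length {R : realType} (a b : R) (c : R -> R * R) : \bar R :=
  ereal_sup [set (polygonal_length a b c s)%:E | s in itv_partition a b].

Definition rectifiable {R : realType} (c : R -> R * R) : Prop :=
  (arc_length 0 1 c < +oo)%E.

(* Parametrization of a rectifiable curve by arc length: the point of c reached
   at the first time at which the travelled length is u. *)
Definition arc_param {R : realType} (c : R -> R * R) (u : R) : R * R :=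
  c (inf [set t | 0 <= t <= 1 /\ (u%:E <= arc_length 0 t c)%E]).

(* \int_c g ds, for c rectifiable. *)
Definition line_integral {R : realType} (g : R * R -> \bar R)
    (c : R -> R * R) : \bar R :=
  (\int[lebesgue_measure]_(u in `[0%R, fine (arc_length 0 1 c)])
     g (arc_param c u))%E.

Definition poincare_density {R : realType} (z : R * R) : R :=
  (1 - cmod z ^+ 2)^-1.

Definition poincare_dist {R : realType} (z w : R * R) : \bar R :=
  ereal_inf [set line_integral (fun x => (poincare_density x)%:E) c |
    c in [set c : R -> R * R |
      [/\ curve_in unit_disk c, rectifiable c, c 0 = z & c 1 = w]]].

Definition hyperbolic_disk {R : realType} (p : R * R) (r : R) : set (R * R) :=
  [set z | unit_disk z /\ (poincare_dist z p < r%:E)%E].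

Definition subdomain {R : realType} (X : set (R * R)) : Prop :=
  [/\ X !=set0, open X, connected X & X `<=` unit_disk].

Definition bloch_radius {R : realType} (X : set (R * R)) : \bar R :=
  ereal_sup [set r%:E | r in [set r : R | 0 < r /\
    exists2 p, unit_disk p & hyperbolic_disk p r `<=` X]].

Definition bloch_subdomain {R : realType} (X : set (R * R)) : Prop :=
  subdomain X /\ (bloch_radius X < +oo)%E.

Definition admissible {R : realType} (G : set (R -> R * R))
    (g : R * R -> \bar R) : Prop :=
  [/\ measurable_fun setT g, (forall z, 0 <= g z)%E &
      forall c, G c -> rectifiable c -> (1 <= line_integral g c)%E].

(* The (conformal) modulus of a family of curves. *)
Definition modulus {R : realType} (G : set (R -> R * R)) : \bar R :=
  ereal_inf [set (\int[lebesgue_measure \x lebesgue_measure]_z (g z ^+ 2))%E |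
    g in admissible G].

Definition self_homeomorphism {R : realType} (D : set (R * R))
    (f : R * R -> R * R) : Prop :=
  exists g : R * R -> R * R,
    [/\ f @` D = D, g @` D = D, {in D, cancel f g} &
        {within D, continuous f} /\ {within D, continuous g}].

(* The geometric definition (Vaisala): the modulus of every family of curves in
   D is distorted by a factor at most K, in both directions. As in that
   definition, maps are not required to preserve orientation. *)
Definition K_quasiconformal {R : realType} (D : set (R * R)) (K : R)
    (f : R * R -> R * R) : Prop :=
  forall G : set (R -> R * R), G `<=` curve_in D ->
    (modulus G <= K%:E * modulus [set f \o c | c in G])%E /\
    (modulus [set f \o c | c in G] <= K%:E * modulus G)%E.

Definition qc_self_homeomorphism {R : realType} (f : R * R -> R * R) : Prop :=
  self_homeomorphism unit_disk f /\
  exists2 K : R, 1 <= K & K_quasiconformal unit_disk K f.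

(* Main.v *)
From HB Require Import structures.
Require Import Defs.
From mathcomp Require Import all_boot all_order all_algebra.
From mathcomp Require Import all_classical all_reals all_analysis.
From mathcomp Require Import measurable_realfun ring lra.

(** Suppose that [f @` X] contains the hyperbolic disk of centre [f p] and radius
    [r]. If [f] maps the points at distance less than [s] from [p] to points at
    distance less than [r] from [f p], then [X] contains the hyperbolic disk of
    centre [p] and radius [s]. So what is needed is a bound for the distance of
    [f p] and [f z] in terms of the distance of [p] and [z] only: for a fixed [s]
    larger than the radii of the disks contained in [X], it bounds the radii of the
    disks contained in [f @` X].

    Hyperbolic distances are compared with Euclidean quantities. If [p] and [z] are
    at distance less than [s], then [cmod (p - z)] is at most a constant times the
    distance of either point to the unit circle ([poincare_dist_lt_cmod]);
    conversely, such a bound controls the length of the segment from [p] to [z]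
    ([poincare_dist_le_segment]). Cutting a segment into boundedly many short steps
    ([qc_distortion]) leaves the case of points [x], [y] that are near each other
    compared with their distance to the circle ([qc_local_distortion]), and this is
    where quasiconformality enters.

    In that case, suppose that [d = 1 - cmod (f y)] is very small compared with
    [cmod (f x - f y)], and let [b] be the point of the unit circle nearest to
    [f y]. Every square centred at [b] whose half-side lies between [d] and about
    [cmod (f x - f y) / 2] separates [f x] from [f y], so it meets the image of the
    segment from [x] to [y]; and being centred on the circle it leaves the disk. It
    therefore contains an arc inside the disk that starts on the image of the
    segment and ends outside of the image of a given compact set
    ([square_arc_leaving]). By the length-area method the modulus of the family of
    these arcs is at least a constant times the logarithm of the ratio of the
    extreme half-sides ([cross_energy_ge], [energy_ge_ln]). The arcs are images of
    curves that lead from the segment out of a square around it of comparable size,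
    a family of modulus at most 16 ([modulus_crossing_le]). As [f] multiplies moduli
    by at most [K], the ratio is bounded. Squares serve better than circles here:
    their sides are parallel to the axes, so that Tonelli's theorem on lines
    replaces integration in polar coordinates.

    Two facts give access to the integrals along curves: the parametrization by arc
    length does not increase distances ([arc_param_lipschitz]), and a curve of
    constant speed is parametrized by arc length up to a dilation
    ([arc_param_constant_speed]). *)

Set Implicit Arguments.
Unset Strict Implicit.
Unset Printing Implicit Defensive.
Import Order.TTheory GRing.Theory Num.Theory.
Import numFieldNormedType.Exports.

Local Open Scope classical_set_scope.
Local Open Scope ring_scope.

(** * The modulus of a complex number *)

Section Cmod.
Context {R : realType}.
Implicit Types (z w : R * R) (c : R -> R * R).

Lemma cmod_ge0 z : 0 <= cmod z.
Proof. exact: sqrtr_ge0. Qed.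

Lemma sqr_cmod z : cmod z ^+ 2 = z.1 ^+ 2 + z.2 ^+ 2.
Proof. by rewrite sqr_sqrtr// addr_ge0 ?sqr_ge0. Qed.

Lemma cmod0 : cmod (0 : R * R) = 0.
Proof. by rewrite /cmod /= !expr0n /= addr0 sqrtr0. Qed.

Lemma cmodN z : cmod (- z) = cmod z.
Proof. by rewrite /cmod /= !sqrrN. Qed.

Lemma cmodC z w : cmod (z - w) = cmod (w - z).
Proof. by rewrite -cmodN opprB. Qed.

Lemma cmodZ (k : R) z : cmod (k *: z) = `|k| * cmod z.
Proof.
by rewrite /cmod /= /GRing.scale /= !exprMn -mulrDr sqrtrM ?sqr_ge0// sqrtr_sqr.
Qed.

Lemma cmod_triangle z w : cmod (z + w) <= cmod z + cmod w.
Proof.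
have z0 := cmod_ge0 z; have w0 := cmod_ge0 w.
have zE := sqr_cmod z; have wE := sqr_cmod w.
have cs : z.1 * w.1 + z.2 * w.2 <= cmod z * cmod w.
  rewrite (le_trans (ler_norm _))// -ler_sqr ?nnegrE ?mulr_ge0//.
  rewrite real_normK ?num_real// exprMn zE wE.
  by have := sqr_ge0 (z.1 * w.2 - z.2 * w.1); nra.
rewrite -ler_sqr ?nnegrE ?cmod_ge0 ?addr_ge0// sqr_cmod /=.
nra.
Qed.

Lemma cmod_eq0 z : cmod z = 0 -> z = 0.
Proof.
move=> z0; have := sqr_cmod z; rewrite z0 expr0n /= => /esym/eqP.
rewrite paddr_eq0 ?sqr_ge0// !sqrf_eq0 => /andP[/eqP z1 /eqP z2].
by case: z z1 z2 {z0} => a b /= -> ->.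
Qed.

Lemma cmod_dist_triangle z w (x : R * R) : cmod (z - x) <= cmod (z - w) + cmod (w - x).
Proof. by rewrite (le_trans _ (cmod_triangle _ _))// addrA subrK. Qed.

Lemma cmod_dist_dist z w : `|cmod z - cmod w| <= cmod (z - w).
Proof.
have h x y : cmod x - cmod y <= cmod (x - y) :> R.
  by rewrite lerBlDr; apply: le_trans (cmod_triangle _ _); rewrite subrK.
by rewrite ler_norml h andbT lerNl opprB cmodC h.
Qed.

Lemma supnormE z : `|z| = Num.max `|z.1| `|z.2|.
Proof. by []. Qed.

Lemma supnorm_le_cmod z : `|z| <= cmod z.
Proof.
have := sqr_cmod z; have := cmod_ge0 z => z0 zE.
have le t : t ^+ 2 <= cmod z ^+ 2 -> `|t| <= cmod z.
  by rewrite -(real_normK (num_real t)) ler_sqr ?nnegrE.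
by rewrite supnormE ge_max !le// zE ?lerDl ?lerDr sqr_ge0.
Qed.

Lemma cmod_le_l1 z : cmod z <= `|z.1| + `|z.2|.
Proof.
rewrite -ler_sqr ?nnegrE ?cmod_ge0 ?addr_ge0// sqr_cmod.
rewrite -(real_normK (num_real z.1)) -(real_normK (num_real z.2)).
have := normr_ge0 z.1; have := normr_ge0 z.2; nra.
Qed.

Lemma cmod_le_supnorm z : cmod z <= 2 * `|z|.
Proof.
apply: le_trans (cmod_le_l1 z) _; rewrite supnormE mulr2n mulrDl mul1r.
by rewrite lerD// le_max lexx ?orbT.
Qed.

Lemma cmod_continuous : continuous (@cmod R).
Proof.
move=> z.
apply: (@continuous_comp _ _ _ (fun z : R * R => z.1 ^+ 2 + z.2 ^+ 2) Num.sqrt);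
  last exact: sqrt_continuous.
by apply: cvgD; apply: (@continuous_comp _ _ _ _ (fun x : R => x ^+ 2));
  [exact: cvg_fst|exact: exprn_continuous|exact: cvg_snd|exact: exprn_continuous].
Qed.

Lemma open_unit_disk : open (@unit_disk R).
Proof.
have -> : @unit_disk R = cmod @^-1` [set x | x < 1] by [].
by apply: open_comp => [z _|]; [exact: cmod_continuous|exact: open_lt].
Qed.

End Cmod.

(** * Arc length *)

Section ArcLength.
Context {R : realType}.
Implicit Types (c : R -> R * R) (s : seq R).

(** The polygonal length as a recursion on the partition, which makes partitions
    easy to extend at either end. *)
Fixpoint chain_length c (a : R) s : R :=
  if s is x :: s' then cmod (c x - c a) + chain_length c x s' else 0.

Lemma polygonal_lengthE a b c s : polygonal_length a b c s = chain_length c a s.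
Proof.
elim: s a => [|x s ih] a; first by rewrite /polygonal_length /= big_geq.
by rewrite /polygonal_length /= big_nat_recl//= -ih.
Qed.

Lemma chain_length_rcons c a s t :
  chain_length c a (rcons s t) = chain_length c a s + cmod (c t - c (last a s)).
Proof. by elim: s a => [|x s ih] a /=; rewrite ?addr0 ?add0r// ih addrA. Qed.

Lemma chain_length_le_arc a b c s : itv_partition a b s ->
  ((chain_length c a s)%:E <= arc_length a b c)%E.
Proof.
by move=> abs; apply: ereal_sup_ubound; exists s => //; rewrite polygonal_lengthE.
Qed.

Lemma arc_length_le a b c (v : \bar R) :
  (forall s, itv_partition a b s -> ((chain_length c a s)%:E <= v)%E) ->
  (arc_length a b c <= v)%E.
Proof.
by move=> h; apply: ge_ereal_sup => _ [s abs <-]; rewrite polygonal_lengthE h.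
Qed.

Lemma arc_lengthxx a c : arc_length a a c = 0%E.
Proof.
apply/eqP; rewrite eq_le; apply/andP; split.
  by apply: arc_length_le => s /itv_partitionxx ->.
have := @chain_length_le_arc a a c [::]; apply.
by rewrite /itv_partition /=.
Qed.

Lemma arc_length_extend a t t' c : t <= t' ->
  (arc_length a t c + (cmod (c t' - c t))%:E <= arc_length a t' c)%E.
Proof.
rewrite le_eqVlt => /predU1P[->|tt']; first by rewrite subrr cmod0 adde0.
rewrite -leeBrDr//; apply: arc_length_le => s [ps /eqP ls].
rewrite leeBrDr// -EFinD -ls -chain_length_rcons; apply: chain_length_le_arc.
by split; rewrite ?last_rcons// rcons_path ps ls.
Qed.

Lemma arc_length_homo a t t' c : t <= t' ->
  (arc_length a t c <= arc_length a t' c)%E.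
Proof.
move=> /(@arc_length_extend a _ _ c); apply: le_trans.
by rewrite leeDl// lee_fin cmod_ge0.
Qed.

Lemma within_dist_lt c (t e : R) : {within `[0, 1], continuous c} -> 0 < e ->
  0 <= t <= 1 -> exists2 d, 0 < d &
    forall t', 0 <= t' <= 1 -> `|t - t'| < d -> cmod (c t - c t') < e.
Proof.
move=> cc e0 t01.
have /subspace_continuousP/(_ t) := cc.
rewrite /= in_itv /= => /(_ t01) /cvgrPdist_lt /(_ (e / 2)).
rewrite divr_gt0// => /(_ isT) [d /= d0 hd]; exists d => // t' t01' tt'.
apply: le_lt_trans (cmod_le_supnorm _) _.
by rewrite mulrC -ltr_pdivlMr//; apply: hd => //=; rewrite in_itv.
Qed.

(** Length is a supremum of continuous functions of the curve, hence lower
    semicontinuous: it cannot jump up at the right end of an interval. *)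
Lemma arc_length_left_continuous c t (v : R) : {within `[0, 1], continuous c} ->
  0 < t <= 1 -> (forall t', 0 <= t' < t -> (arc_length 0 t' c <= v%:E)%E) ->
  (arc_length 0 t c <= v%:E)%E.
Proof.
move=> cc /andP[t0 t1] h; apply: arc_length_le => s [ps /eqP ls].
case/lastP: s ps ls => [|s x] /=; first by move=> _ t0'; rewrite t0' ltxx in t0.
rewrite last_rcons rcons_path => /andP[ps lt] xt; subst x.
rewrite lee_fin; apply/ler_addgt0Pr => e e0.
have l0 : 0 <= last 0 s by apply: (@itv_partition_le _ _ _ _ s); split.
have [|d d0 hd] := within_dist_lt cc e0 (t := t); first by rewrite ltW.
pose t' := Num.max ((last 0 s + t) / 2) (t - d / 2).
have lt' : last 0 s < t' by rewrite lt_max midf_lt.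
have tt' : t' < t by rewrite gt_max midf_lt//=; lra.
have t'0 : 0 <= t' by rewrite (le_trans l0)// ltW.
have td : t - d / 2 <= t' by rewrite le_max lexx orbT.
have : ((chain_length c 0 (rcons s t'))%:E <= v%:E)%E.
  apply: le_trans (h t' _); last by rewrite t'0.
  by apply: chain_length_le_arc; split; rewrite ?last_rcons// rcons_path ps.
rewrite !chain_length_rcons lee_fin => /lerD -/(_ _ _ (ltW (hd t' _ _))) h'.
apply: le_trans (h' _ _); last 2 first.
- by rewrite t'0 (le_trans (ltW tt')).
- by rewrite ger0_norm; lra.
by rewrite -addrA lerD2l addrC cmod_dist_triangle.
Qed.

End ArcLength.

(** * Parametrization by arc length *)

Section ArcParam.
Context {R : realType}.
Variable c : R -> R * R.
Hypothesis cc : {within `[0, 1], continuous c}.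
Hypothesis rc : rectifiable c.
Let L := fine (arc_length 0 1 c).

Let hits (u : R) : set R := [set t | 0 <= t <= 1 /\ (u%:E <= arc_length 0 t c)%E].
Let hit (u : R) : R := inf (hits u).

Lemma arc_length_ge0 (t : R) : 0 <= t -> (0 <= arc_length 0 t c)%E.
Proof. by move=> /(arc_length_homo 0 c); rewrite arc_lengthxx. Qed.

Lemma arc_length_finE : arc_length 0 1 c = L%:E.
Proof. by rewrite fineK// ge0_fin_numE// arc_length_ge0. Qed.

Lemma arc_length_total_ge0 : 0 <= L.
Proof. by rewrite -lee_fin -arc_length_finE arc_length_ge0. Qed.

Let hits1 u : u <= L -> hits u 1.
Proof. by move=> uL; split; rewrite ?ler01 ?lexx// arc_length_finE lee_fin. Qed.

Let hits_lb u : lbound (hits u) 0.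
Proof. by move=> t [/andP[]]. Qed.

Let has_inf_hits u : u <= L -> has_inf (hits u).
Proof. by move=> uL; split; [exists 1; exact: hits1|exists 0; exact: hits_lb]. Qed.

Let hit_le u t : hits u t -> hit u <= t.
Proof. by apply: ge_inf; exists 0; exact: hits_lb. Qed.

Let hit01 u : u <= L -> 0 <= hit u <= 1.
Proof.
move=> uL; rewrite hit_le ?andbT; last exact: hits1.
by apply: lb_le_inf; [exists 1; exact: hits1|exact: hits_lb].
Qed.

Let hit_lt u x : u <= L -> hit u < x -> exists2 t, hits u t & t < x.
Proof.
move=> uL ux; have x0 : 0 < x - hit u by rewrite subr_gt0.
by have [t ht] := inf_adherent x0 (has_inf_hits uL); rewrite subrKC; exists t.
Qed.

(** Before the time [hit u] the length is less than [u], and length does not jump up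
    at the right end of an interval. *)
Let arc_length_hit u : 0 <= u <= L -> (arc_length 0 (hit u) c <= u%:E)%E.
Proof.
move=> /andP[u0 uL]; have /andP[h0 h1] := hit01 uL.
move: h0; rewrite le_eqVlt => /predU1P[<-|h0]; first by rewrite arc_lengthxx.
apply: (arc_length_left_continuous cc); first by rewrite h0.
move=> t /andP[t0 th]; rewrite leNgt; apply/negP => ut.
have : hit u <= t.
  by apply: hit_le; split; [rewrite t0 (le_trans (ltW th))|exact: ltW].
by rewrite leNgt th.
Qed.

(** Two points of the arc-length parametrization are joined by a piece of the
    curve of length at most the difference of the parameters, and a chord is no
    longer than the arc. *)
Lemma arc_param_lipschitz (u v : R) : 0 <= u -> u <= v -> v <= L ->
  cmod (arc_param c v - arc_param c u) <= v - u.
Proof.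
move=> u0 uv vL; have uL := le_trans uv vL.
rewrite /arc_param -/(hit u) -/(hit v).
have [t01 /andP[_ v1]] := (hit01 uL, hit01 vL).
have : hit u <= hit v.
  apply: lb_le_inf; first by exists 1; exact: hits1.
  move=> t [? vt]; apply: hit_le; split => //.
  by apply: le_trans vt; rewrite lee_fin.
rewrite le_eqVlt => /predU1P[<-|huv]; first by rewrite subrr cmod0 subr_ge0.
apply/ler_addgt0Pr => e e0; have [d d0 hd] := within_dist_lt cc e0 t01.
have [|t ht] := @hit_lt u (Num.min (hit v) (hit u + d)) uL.
  by rewrite lt_min huv ltrDl.
rewrite lt_min => /andP[tv td]; have ut := hit_le ht; case: ht => t01' ut'.
apply: le_trans (cmod_dist_triangle _ (c t) _) _.
apply: lerD; last first.
  by rewrite cmodC ltW// hd// distrC ger0_norm ?subr_ge0// ltrBlDl.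
rewrite lerBrDl -lee_fin EFinD.
apply: le_trans (leeD2r _ ut') _.
apply: le_trans (arc_length_extend _ _ (ltW tv)) _.
by apply: arc_length_hit; rewrite (le_trans u0).
Qed.

Lemma arc_param0 : arc_param c 0 = c 0.
Proof.
rewrite /arc_param -/(hit 0); congr (c _); apply/eqP; rewrite eq_le.
have /andP[-> _] := hit01 arc_length_total_ge0; rewrite andbT.
by apply: hit_le; split; rewrite ?lexx ?ler01// arc_lengthxx.
Qed.

Lemma arc_param1 : arc_param c L = c 1.
Proof.
rewrite /arc_param -/(hit L); have h01 := hit01 (lexx L).
have : hit L <= 1 by case/andP: h01.
rewrite le_eqVlt => /predU1P[->//|h1].
apply/eqP; rewrite eq_sym -subr_eq0; apply/eqP/cmod_eq0/eqP.
rewrite eq_le cmod_ge0 andbT; apply/ler_addgt0Pr => e e0; rewrite add0r.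
have [d d0 hd] := within_dist_lt cc e0 h01.
have [|t ht] := @hit_lt L (Num.min 1 (hit L + d)) (lexx L).
  by rewrite lt_min h1 ltrDl.
rewrite lt_min => /andP[t1 td]; have ut := hit_le ht; case: ht => t01 Lt.
(* past the parameter t there is no length left, so the curve stays at c t *)
have ct : cmod (c 1 - c t) <= 0.
  rewrite -(lerD2l L) addr0 -lee_fin -[leRHS]arc_length_finE EFinD.
  by apply: le_trans (leeD2r _ Lt) _; exact: arc_length_extend (ltW t1).
apply: le_trans (cmod_dist_triangle _ (c t) _) _; rewrite -[leRHS]add0r.
apply: lerD => //.
by rewrite cmodC ltW// hd// distrC ger0_norm ?subr_ge0// ltrBlDl.
Qed.

Lemma arc_param_in (D : set (R * R)) (u : R) : c @` `[0, 1] `<=` D -> u <= L -> D (arc_param c u).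
Proof. by move=> cD uL; apply: cD; exists (hit u) => //=; rewrite in_itv/= hit01. Qed.

End ArcParam.

(** * Curves of constant speed *)

Section ConstantSpeed.
Context {R : realType}.
Implicit Types (c : R -> R * R).

Lemma chain_length_lipschitz c (l a : R) s :
  {in `[0, 1] &, forall x y : R, cmod (c x - c y) <= l * `|x - y|} ->
  0 <= a -> path <%O a s -> last a s <= 1 ->
  chain_length c a s <= l * (last a s - a).
Proof.
move=> hl; elim: s a => [|x s ih] a a0 /=; first by rewrite subrr mulr0.
move=> /andP[ax ps] l1; have x0 : 0 <= x by rewrite (le_trans a0)// ltW.
have xl : x <= last x s by apply: (@itv_partition_le _ _ _ _ s); split.
have := lerD (hl x a _ _) (ih x x0 ps l1); rewrite !in_itv/= => h.
apply: le_trans (h _ _) _; first by rewrite x0 (le_trans xl).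
  by rewrite a0 (le_trans (ltW ax))// (le_trans xl).
have xa : 0 <= x - a by rewrite subr_ge0 ltW.
by rewrite ger0_norm//; lra.
Qed.

Lemma arc_length_lipschitz c (l t : R) :
  {in `[0, 1] &, forall x y : R, cmod (c x - c y) <= l * `|x - y|} ->
  t <= 1 -> (arc_length 0 t c <= (l * t)%:E)%E.
Proof.
move=> hl t1; apply: arc_length_le => s [ps /eqP ls]; rewrite lee_fin.
by have := chain_length_lipschitz hl (lexx 0) ps; rewrite ls subr0; exact.
Qed.

(** The lower bound is a continuous induction: length grows at least as fast as
    the distance to the current point, so the set of parameters up to which it
    is at least [l * t] cannot end before the last one. *)
Lemma arc_length_constant_speed c (l : R) : 0 <= l ->
  {in `[0, 1] &, forall x y : R, cmod (c x - c y) <= l * `|x - y|} ->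
  (forall x : R, 0 <= x < 1 -> exists2 d : R, 0 < d &
     forall y : R, x <= y <= x + d -> y <= 1 -> cmod (c y - c x) = l * (y - x)) ->
  forall t : R, 0 <= t <= 1 -> arc_length 0 t c = (l * t)%:E.
Proof.
move=> l0 hl hloc t /andP[t0 t1]; apply/eqP; rewrite eq_le; apply/andP; split.
  exact: arc_length_lipschitz.
pose A := [set x | 0 <= x <= t /\ ((l * x)%:E <= arc_length 0 x c)%E].
have A0 : A 0 by split; rewrite ?lexx// mulr0 arc_lengthxx.
have ubA : ubound A t by move=> x [/andP[]].
have supA : has_sup A by split; [exists 0|exists t].
have T0 : 0 <= sup A by apply: ub_le_sup => //; exists t.
have Tt : sup A <= t by apply: ge_sup => //; exists 0.
have AT : ((l * sup A)%:E <= arc_length 0 (sup A) c)%E.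
  apply/lee_addgt0Pr => e e0.
  have e1 : 0 < e / (l + 1) by rewrite divr_gt0// ltr_wpDl.
  have [x Ax xe] := sup_adherent e1 supA; case: (Ax) => _ lx.
  have xT : x <= sup A by apply: ub_le_sup => //; exists t.
  apply: le_trans (leeD2r _ (arc_length_homo 0 c xT)).
  apply: le_trans (leeD2r _ lx); rewrite -EFinD lee_fin.
  have : l * (e / (l + 1)) <= e.
    rewrite mulrA ler_pdivrMr ?ltr_wpDl//; nra.
  nra.
have := Tt; rewrite le_eqVlt => /predU1P[TE|Tlt]; first by rewrite -TE.
have [|d d0 hd] := hloc (sup A); first by rewrite T0 (lt_le_trans Tlt).
pose y := Num.min t (sup A + d).
have Ty : sup A < y by rewrite lt_min Tlt ltrDl.
suff /(ub_le_sup _) : A y by move=> /(_ (ex_intro _ t ubA)); rewrite leNgt Ty.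
have yt : y <= t by rewrite ge_min lexx.
split; first by rewrite (le_trans T0 (ltW Ty)) yt.
apply: le_trans (arc_length_extend 0 c (ltW Ty)).
rewrite hd; [|by rewrite (ltW Ty) ge_min lexx orbT|exact: le_trans yt t1].
by apply: le_trans (leeD2r _ AT); rewrite -EFinD -mulrDr subrKC.
Qed.

Lemma arc_param_constant_speed c (l : R) : 0 < l ->
  (forall t : R, 0 <= t <= 1 -> arc_length 0 t c = (l * t)%:E) ->
  forall u : R, 0 <= u <= l -> arc_param c u = c (u / l).
Proof.
move=> l0 hl u /andP[u0 ul]; rewrite /arc_param; congr (c _).
have ul01 : 0 <= u / l <= 1 by rewrite divr_ge0 ?(ltW l0)//= ler_pdivrMr ?mul1r.
apply/eqP; rewrite eq_le; apply/andP; split.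
  apply: ge_inf; first by exists 0 => t [/andP[]].
  by split=> //; rewrite hl// mulrC divfK// gt_eqF.
apply: lb_le_inf; first by exists (u / l); split=> //; rewrite hl// mulrC divfK// gt_eqF.
by move=> t [t01]; rewrite hl// lee_fin ler_pdivrMr// mulrC.
Qed.

End ConstantSpeed.

(** * Translations and reflections of the line *)

Section AffineSubstitution.
Context {R : realType}.

(** A constant with a registered measurability proof, so that its image measures are
    recognized as measures. *)
Definition affine (b s : R) : measurableTypeR R -> measurableTypeR R :=
  fun u => b + s * u.

Lemma measurable_affine b s : measurable_fun setT (affine b s).
Proof. by apply: measurable_funD => //; apply: measurable_funM. Qed.

HB.instance Definition _ b s :=
  isMeasurableFun.Build _ _ _ _ (affine b s) (@measurable_affine b s).

Variables b s : R.
Hypothesis s1 : s = 1 \/ s = -1.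

Lemma lebesgue_measure_affine (A : set R) : measurable A ->
  pushforward lebesgue_measure (affine b s) A = lebesgue_measure A.
Proof.
move=> mA; apply/esym/lebesgue_measure_unique => //= _ [[x y]] _ <-.
rewrite /pushforward /affine; case: s1 => ->.
  have -> : (fun u => b + 1 * u) @^-1` [set` `]x, y] ] = `]x - b, y - b]%classic.
    by apply/seteqP; split=> u /=; rewrite !in_itv /=; lra.
  rewrite !lebesgue_measure_itv /= !lte_fin ltrD2r.
  by case: ifP => // _; rewrite -!EFinB; congr EFin; lra.
have -> : (fun u => b + -1 * u) @^-1` [set` `]x, y] ] = `[b - y, b - x[%classic.
  by apply/seteqP; split=> u /=; rewrite !in_itv /=; lra.
rewrite !lebesgue_measure_itv /= !lte_fin ltrD2l ltrN2.
by case: ifP => // _; rewrite -!EFinB; congr EFin; lra.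
Qed.

Lemma ge0_integral_affine (D : set R) (f : R -> \bar R) : measurable D ->
  measurable_fun D f -> {in D, forall x, (0 <= f x)%E} ->
  (\int[lebesgue_measure]_(x in affine b s @^-1` D) f (b + s * x)%R =
   \int[lebesgue_measure]_(x in D) f x)%E.
Proof.
move=> mD mf f0.
rewrite -[LHS](@ge0_integral_pushforward _ _ _ _ _ (affine b s) (@measurable_affine b s)
  lebesgue_measure D f)//.
by apply: eq_measure_integral => A mA _; exact: lebesgue_measure_affine.
Qed.

Lemma measurable_comp_affine (f : R -> \bar R) :
  measurable_fun [set: measurableTypeR R] f ->
  measurable_fun [set: measurableTypeR R] (fun u => f (b + s * u)%R).
Proof. by move=> mf; exact: (measurableT_comp mf (measurable_affine b s)). Qed.

Lemma ge0_integralT_affine (f : R -> \bar R) :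
  measurable_fun [set: measurableTypeR R] f -> (forall x, 0 <= f x)%E ->
  (\int[lebesgue_measure]_x f (b + s * x)%R = \int[lebesgue_measure]_x f x)%E.
Proof.
move=> mf f0; by rewrite -[RHS]ge0_integral_affine ?preimage_setT.
Qed.

End AffineSubstitution.

Lemma ge0_integral_reflect (R : realType) (f : R -> \bar R) (b : R) :
  measurable_fun [set: measurableTypeR R] f -> (forall x, 0 <= f x)%E ->
  (\int[lebesgue_measure]_x (f (b + 1 * x)%R + f (b + -1 * x)%R) =
   \int[lebesgue_measure]_x f x + \int[lebesgue_measure]_x f x)%E.
Proof.
move=> mf f0; rewrite ge0_integralD//.
- congr (_ + _)%E; apply: ge0_integralT_affine => //; first by left.
  by right.
- exact: measurable_comp_affine.
- exact: measurable_comp_affine.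
Qed.

(** * Line integrals along distance-nonincreasing maps *)

Section Clamp.
Context {R : realType}.
Implicit Types x y L : R.

Definition clamp L x := Num.max 0 (Num.min x L).

Lemma clamp_itv L x : 0 <= L -> 0 <= clamp L x <= L.
Proof. by move=> L0; rewrite le_max lexx/= ge_max L0 ge_min lexx orbT. Qed.

Lemma clampE L x : 0 <= x <= L -> clamp L x = x.
Proof. by move=> /andP[x0 xL]; rewrite /clamp (min_idPl xL) (max_idPr x0). Qed.

Lemma clamp_homo L x y : x <= y -> clamp L x <= clamp L y.
Proof. by rewrite /clamp /Num.max /Num.min => xy; do ?case: ifP; lra. Qed.

Lemma clamp_lipschitz L x y : `|clamp L y - clamp L x| <= `|y - x|.
Proof.
wlog xy : x y / x <= y.
  by move=> h; case/orP: (le_total x y) => /h // {}h; rewrite distrC (distrC y).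
rewrite !ger0_norm ?subr_ge0 ?clamp_homo//.
by move: xy; rewrite /clamp /Num.max /Num.min; do ?case: ifP; lra.
Qed.

End Clamp.

Section LipschitzCurves.
Context {R : realType}.
Local Notation mu := (@lebesgue_measure R).

Definition lipschitz1 (g : R -> R * R) :=
  forall u v, cmod (g v - g u) <= `|v - u|.

Lemma lipschitz1_continuous (g : R -> R * R) : lipschitz1 g -> continuous g.
Proof.
move=> gl u; apply/cvgrPdist_lt => e e0; near=> v.
apply: le_lt_trans (supnorm_le_cmod _) _; apply: le_lt_trans (gl _ _) _.
by near: v; apply: cvgr_dist_lt.
Unshelve. all: by end_near. Qed.

Lemma lipschitz1_measurable (g : R -> R * R) :
  lipschitz1 g -> measurable_fun [set: measurableTypeR R] g.
Proof.
move=> /lipschitz1_continuous gc; apply/measurable_fun_pairP; split.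
  apply: continuous_measurable_fun => u.
  by apply: continuous_comp; [exact: gc|exact: cvg_fst].
apply: continuous_measurable_fun => u.
by apply: continuous_comp; [exact: gc|exact: cvg_snd].
Qed.

(** The arc-length parametrization, continued by constants beyond its interval, does
    not increase distances on the whole line; this makes it continuous, hence
    measurable, which integrals along it need. *)
Lemma line_integral_lipschitz1 (D : set (R * R)) (c : R -> R * R) :
  curve_in D c -> rectifiable c ->
  exists (L : R) (g : R -> R * R),
  [/\ 0 <= L, arc_length 0 1 c = L%:E & lipschitz1 g] /\
  [/\ g 0 = c 0, g L = c 1, forall u, D (g u),
    forall u, 0 <= u <= L -> g u = arc_param c u &
    forall F, line_integral F c = (\int[mu]_(u in `[0%R, L]) F (g u))%E].
Proof.
move=> [cc cD] rc; pose L := fine (arc_length 0 1 c).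
have L0 : 0 <= L := arc_length_total_ge0 rc.
have kL u : 0 <= clamp L u <= L := clamp_itv u L0.
exists L, (arc_param c \o clamp L); split; split; rewrite /comp.
- exact: L0.
- exact: arc_length_finE.
- move=> u v; apply: le_trans (clamp_lipschitz L u v).
  wlog uv : u v / clamp L u <= clamp L v.
    by move=> h; case/orP: (le_total (clamp L u) (clamp L v)) => /h // {}h;
       rewrite cmodC distrC.
  rewrite ger0_norm ?subr_ge0//; apply: arc_param_lipschitz => //.
    by case/andP: (kL u).
  by case/andP: (kL v).
- by rewrite clampE ?L0 ?lexx// arc_param0.
- by rewrite clampE ?L0 ?lexx// arc_param1.
- by move=> u; apply: (arc_param_in rc cD); case/andP: (kL u).
- by move=> u /clampE ->.
- move=> F; apply: eq_integral => u; rewrite inE/= in_itv/= => u0L.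
  by rewrite clampE.
Qed.

End LipschitzCurves.

(** * Hyperbolic distance and distance to the unit circle *)

Section PoincareDistance.
Context {R : realType}.
Local Notation mu := (@lebesgue_measure R).

Lemma integral_cst_segment (k a b : R) : a <= b ->
  (\int[mu]_(u in `[a, b]) k%:E = (k * (b - a))%:E)%E.
Proof.
move=> ab; transitivity (k%:E * mu `[a, b])%E.
  exact: (@integral_cst _ _ R mu `[a, b] (measurable_itv _) k%:E).
rewrite /= lebesgue_measure_itv/= lte_fin.
move: ab; rewrite le_eqVlt => /predU1P[->|->]; last by rewrite EFinM EFinB.
by rewrite ltxx subrr mulr0 mule0.
Qed.

Lemma integral_inv (a b : R) : 0 < a -> a <= b ->
  (\int[mu]_(t in `[a, b]) (t^-1)%:E = (ln b - ln a)%:E)%E.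
Proof.
move=> a0; rewrite le_eqVlt => /predU1P[<-|ab].
  by rewrite set_itv1 integral_set1 subrr.
have dln t : a <= t -> is_derive t 1 (@ln R) t^-1.
  by move=> at_; apply: is_derive1_ln; exact: lt_le_trans at_.
have cln t : a <= t -> {for t, continuous (@ln R)}.
  by move=> at_; apply: continuous_ln; exact: lt_le_trans at_.
rewrite (@continuous_FTC2 R (fun t => t^-1) (@ln R)) ?EFinB//.
- apply: continuous_in_subspaceT => t; rewrite inE/= in_itv/= => /andP[at_ _].
  by apply: inv_continuous; rewrite gt_eqF// (lt_le_trans a0).
- split.
  + by move=> t; rewrite in_itv/= => /andP[/ltW/dln dt _]; exact: ex_derive.
  + by apply: cvg_at_right_filter; exact: cln.
  + by apply: cvg_at_left_filter; apply: cln; exact: ltW.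
- move=> t; rewrite in_itv/= => /andP[/ltW/dln dt _].
  by rewrite derive1E derive_val.
Qed.

Lemma poincare_density_continuous (z : R * R) : cmod z < 1 ->
  {for z, continuous (@poincare_density R)}.
Proof.
move=> z1; apply: cvgV; last first.
  apply: cvgB; first exact: cvg_cst.
  by apply: (@continuous_comp _ _ _ _ (fun x : R => x ^+ 2));
    [exact: cmod_continuous|exact: exprn_continuous].
by rewrite gt_eqF// subr_gt0 expr_lt1// cmod_ge0.
Qed.

Lemma measurable_poincare_density (g : R -> R * R) : lipschitz1 g ->
  (forall u, unit_disk (g u)) ->
  measurable_fun [set: measurableTypeR R] (fun u => (poincare_density (g u))%:E).
Proof.
move=> gl gD; apply/measurable_EFinP; apply: continuous_measurable_fun => u.
apply: (@continuous_comp _ _ _ g (@poincare_density R)).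
  exact: lipschitz1_continuous.
exact: poincare_density_continuous (gD u).
Qed.

(** Along a curve the distance to the unit circle changes at most at unit speed,
    so the density is at least that of a straight run away from the circle. *)
Lemma poincare_length_ge (g : R -> R * R) (L : R) : lipschitz1 g ->
  (forall u, unit_disk (g u)) -> 0 <= L ->
  (((ln (1 - cmod (g 0) + L) - ln (1 - cmod (g 0))) / 2)%:E <=
   \int[mu]_(u in `[0%R, L]) (poincare_density (g u))%:E)%E.
Proof.
move=> gl gD L0; set d := 1 - cmod (g 0).
have d0 : 0 < d by rewrite subr_gt0; exact: gD.
have mdu : measurable_fun `[0, L] (fun u : measurableTypeR R => (d + 1 * u)^-1).
  apply: subspace_continuous_measurable_fun => //.
  apply: continuous_in_subspaceT => u; rewrite inE/= in_itv/= => /andP[u0 _].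
  apply: cvgV; first by rewrite mul1r gt_eqF// ltr_wpDr.
  by apply: cvgD; [exact: cvg_cst|apply: cvgMr; exact: cvg_id].
have <- : (\int[mu]_(u in `[0%R, L]) (2^-1 * (d + 1 * u)^-1)%:E =
           ((ln (d + L) - ln d) / 2)%:E)%E.
  under eq_integral do rewrite EFinM.
  have mi : measurable_fun `[d, d + L] (fun x : measurableTypeR R => (x^-1)%:E).
    apply/measurable_EFinP; apply: subspace_continuous_measurable_fun => //.
    apply: continuous_in_subspaceT => t; rewrite inE/= in_itv/= => /andP[dt _].
    by apply: inv_continuous; rewrite gt_eqF// (lt_le_trans d0).
  have i0 : {in `[d, d + L]%classic, forall x : measurableTypeR R, (0 <= (x^-1)%:E)%E}.
    move=> x; rewrite inE/= in_itv/= => /andP[dx _].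
    by rewrite lee_fin invr_ge0 (le_trans (ltW d0)).
  have pre : affine d 1 @^-1` `[d, d + L] = `[0, L]%classic.
    by apply/seteqP; split=> u; rewrite /affine/= !in_itv/=; lra.
  have := ge0_integral_affine d (or_introl erefl) (measurable_itv _) mi i0.
  rewrite integral_inv ?lerDl// pre => sub.
  rewrite ge0_integralZl_EFin ?invr_ge0//.
  - by rewrite sub -EFinM mulrC.
  - move=> u; rewrite /= in_itv/= => /andP[u0 _].
    by rewrite lee_fin invr_ge0 mul1r addr_ge0// ltW.
  - by apply/measurable_EFinP.
apply: ge0_le_integral => //.
- move=> u; rewrite /= in_itv/= => /andP[u0 _].
  by rewrite lee_fin mulr_ge0 ?invr_ge0// mul1r addr_ge0// ltW.
- by apply/measurable_EFinP; apply: measurable_funM.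
- by apply: measurable_funTS; exact: measurable_poincare_density.
move=> u; rewrite /= in_itv/= => /andP[u0 _]; rewrite lee_fin mul1r.
have gu1 : cmod (g u) < 1 := gD u.
have du : 0 < d + u by rewrite ltr_wpDr.
have gu : cmod (g 0) <= cmod (g u) + u.
  rewrite -lerBlDl -[leRHS](ger0_norm u0) -[u in leRHS]subr0.
  apply: le_trans (gl 0 u); rewrite cmodC lerBlDr.
  by apply: le_trans (cmod_triangle _ _); rewrite subrK.
have gu0 := cmod_ge0 (g u).
rewrite /poincare_density -invfM lef_pV2 ?posrE ?mulr_gt0// /d in du *; nra.
Qed.

(** A curve is at least as long as the distance of its ends, so that the preceding
    bound, applied from either end, limits this distance. *)
Lemma poincare_dist_lt_cmod (z w : R * R) (s : R) :
  (poincare_dist z w < s%:E)%E ->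
  cmod (z - w) <= expR (2 * s) * (1 - cmod z) /\
  cmod (z - w) <= expR (2 * s) * (1 - cmod w).
Proof.
move=> /ereal_inf_lt[_ [c [cD rc c0 c1] <-] cs].
have [L [g [[L0 _ gl] [g0 gL gD _ gF]]]] := line_integral_lipschitz1 cD rc.
move: cs; rewrite {}gF => cs.
have zwL : cmod (z - w) <= L.
  by rewrite -c0 -c1 -g0 -gL cmodC (le_trans (gl _ _))// subr0 ger0_norm.
have key (h : R -> R * R) : lipschitz1 h -> (forall u, unit_disk (h u)) ->
    (\int[mu]_(u in `[0%R, L]) (poincare_density (h u))%:E < s%:E)%E ->
    L <= expR (2 * s) * (1 - cmod (h 0)).
  move=> hl hD /(le_lt_trans (poincare_length_ge hl hD L0)).
  have d0 : 0 < 1 - cmod (h 0) by rewrite subr_gt0; exact: hD.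
  have dL : 0 < 1 - cmod (h 0) + L by rewrite ltr_wpDr.
  rewrite lte_fin -ln_div ?posrE// ltr_pdivrMr// (mulrC s) -ltr_expR lnK ?posrE ?divr_gt0//.
  by rewrite ltr_pdivrMr// => /ltW; apply: le_trans; rewrite lerDr ltW.
split; apply: le_trans zwL _; first by rewrite -c0 -g0; exact: key.
have -> : w = g (L + -1 * 0) by rewrite mulr0 addr0 gL.
apply: (key (fun u => g (L + -1 * u))) => //.
  move=> u v; apply: le_trans (gl _ _) _.
  have -> : L + -1 * v - (L + -1 * u) = u - v by ring.
  by rewrite distrC.
have pre : affine L (-1) @^-1` `[0, L] = `[0, L]%classic.
  by apply/seteqP; split=> u; rewrite /affine/= !in_itv/=; lra.
have := @ge0_integral_affine R L (-1) (or_intror erefl) _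
  (fun u => (poincare_density (g u))%:E) (measurable_itv `[0, L]).
rewrite pre => -> //; first by apply: measurable_funTS; exact: measurable_poincare_density.
move=> u _; rewrite lee_fin invr_ge0 subr_ge0 expr_le1// ?cmod_ge0// ltW//.
exact: gD.
Qed.

(** The straight segment stays as far from the unit circle as its endpoints, by
    convexity of the modulus. *)
Lemma poincare_dist_le_segment (z w : R * R) (d : R) : 0 < d ->
  cmod z <= 1 - d -> cmod w <= 1 - d ->
  (poincare_dist z w <= (cmod (z - w) / d)%:E)%E.
Proof.
move=> d0 zd wd; pose c t := z + t *: (w - z).
pose D := [set x : R * R | cmod x <= 1 - d].
have cl : {in `[0, 1] &, forall x y : R, cmod (c x - c y) <= cmod (z - w) * `|x - y|}.
  move=> x y _ _; rewrite /c opprD addrACA subrr add0r -scalerBl cmodZ.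
  by rewrite mulrC (cmodC w).
have cD : curve_in D c.
  split.
    apply: continuous_subspaceT => t; apply: cvgD; first exact: cvg_cst.
    by apply: cvgZr_tmp; exact: cvg_id.
  move=> _ [t + <-]; rewrite /= in_itv/= => /andP[t0 t1].
  rewrite /D /=.
  have -> : c t = (1 - t) *: z + t *: w.
    by rewrite /c scalerBl scale1r scalerBr addrA addrAC.
  apply: le_trans (cmod_triangle _ _) _; rewrite !cmodZ !ger0_norm ?subr_ge0//.
  have := cmod_ge0 z; have := cmod_ge0 w; nra.
have cD1 : curve_in unit_disk c.
  by case: cD => ? cD; split=> // x /cD; rewrite /D/unit_disk/= => ?; lra.
have L1 := arc_length_lipschitz cl (lexx 1); rewrite mulr1 in L1.
have rc : rectifiable c by apply: le_lt_trans L1 _; rewrite ltry.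
have [L [g [[L0 LE gl] [g0 gL gD _ gF]]]] := line_integral_lipschitz1 cD rc.
apply: (@le_trans _ _ (line_integral (fun x => (poincare_density x)%:E) c)).
  apply: ereal_inf_lbound; exists c => //; split=> //.
    by rewrite /c scale0r addr0.
  by rewrite /c scale1r subrKC.
rewrite gF; apply: (@le_trans _ _ (\int[mu]_(u in `[0%R, L]) (d^-1)%:E)%E).
  apply: ge0_le_integral => //.
  - move=> u _; rewrite lee_fin invr_ge0 subr_ge0 expr_le1// ?cmod_ge0//.
    by rewrite (le_trans (gD u))//; lra.
  - apply: measurable_funTS; apply: measurable_poincare_density => // u.
    by rewrite /unit_disk/= (le_lt_trans (gD u))//; lra.
  move=> u _; rewrite lee_fin lef_pV2 ?posrE//; last first.
    have := gD u; have := cmod_ge0 (g u); rewrite /D/=; nra.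
  have := gD u; have := cmod_ge0 (g u); rewrite /D/=; nra.
rewrite integral_cst_segment ?subr0 // lee_fin mulrC ler_pM2r ?invr_gt0//.
by rewrite -lee_fin -LE.
Qed.

End PoincareDistance.

(** * Upper bound for the modulus of curves crossing a square annulus *)

Section ModulusUpperBound.
Context {R : realType}.
Local Notation mu := (@lebesgue_measure R).

(** The metric that is constant on the square of half-side [2 * a] gives length
    at least 1 to the crossings, and its energy does not depend on [a]. *)
Lemma modulus_crossing_le (m : R * R) (a : R) (G : set (R -> R * R)) : 0 < a ->
  (forall c, G c -> [/\ {within `[0, 1], continuous c}, `|c 0 - m| <= a &
                        2 * a <= `|c 1 - m|]) ->
  (modulus G <= 16%:E)%E.
Proof.
move=> a0 hG; pose I (x : R) := `[x - 2 * a, x + 2 * a]%classic.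
pose S : set (R * R) := I m.1 `*` I m.2.
have mS : measurable S by apply: measurableX; exact: measurable_itv.
have inS z : `|z - m| <= 2 * a -> S z.
  rewrite supnormE ge_max /= !ler_norml => /andP[h1 h2].
  by split; rewrite /I /= in_itv /=; lra.
pose g (z : R * R) : \bar R := (a^-1 * \1_S z)%:E.
have mg : measurable_fun setT g.
  apply/measurable_EFinP; apply: measurable_funM; first exact: measurable_cst.
  exact: measurable_indic.
have g0 z : (0 <= g z)%E by rewrite lee_fin mulr_ge0// invr_ge0 ltW.
have gadm : admissible G g.
  split=> // c /hG[cc ca c2a] rc.
  have cT : curve_in [set: R * R] c by split.
  have [L [k [[L0 _ kl] [k0 kL _ _ ->]]]] := line_integral_lipschitz1 cT rc.
  have aL : a <= L.
    have := kl 0 L; rewrite subr0 (ger0_norm L0) k0 kL => /(le_trans (supnorm_le_cmod _)).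
    have : `|c 1 - m| <= `|c 1 - c 0| + `|c 0 - m|.
      by rewrite (le_trans _ (ler_normD _ _))// addrA subrK.
    lra.
  apply: (@le_trans _ _ (\int[mu]_(u in `[0%R, a]) g (k u))%E); last first.
    apply: ge0_subset_integral => //.
      apply: measurable_funTS; apply: measurableT_comp => //.
      exact: lipschitz1_measurable.
    by move=> u; rewrite /= !in_itv/=; lra.
  rewrite [leRHS](_ : _ = \int[mu]_(u in `[0%R, a]) (a^-1)%:E)%E.
    by rewrite integral_cst_segment ?subr0 1?mulVf ?gt_eqF// ltW.
  apply: eq_integral => u; rewrite inE/= in_itv/= => /andP[u0 ua].
  rewrite /g indicE mem_set ?mulr1//; apply: inS.
  have : `|k u - m| <= `|k u - k 0| + `|k 0 - m|.
    by rewrite (le_trans _ (ler_normD _ _))// addrA subrK.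
  have := le_trans (supnorm_le_cmod _) (kl 0 u).
  by rewrite subr0 (ger0_norm u0) k0; lra.
apply: (@le_trans _ _ (\int[mu \x mu]_z (g z ^+ 2))%E).
  by apply: ereal_inf_lbound; exists g.
have gE z : (g z ^+ 2 = (a^-1 ^+ 2)%:E * (\1_S z)%:E)%E.
  rewrite /g -EFin_expe exprMn -EFinM; congr (_ * _)%:E.
  by rewrite indicE; case: (z \in S); rewrite ?expr1n ?expr0n.
under eq_integral do rewrite gE.
rewrite ge0_integralZl_EFin ?sqr_ge0//; last first.
  by apply/measurable_EFinP; exact: measurable_indic.
have muI x : mu (I x) = (4 * a)%:E.
  rewrite /I lebesgue_measure_itv/= lte_fin ifT; last by lra.
  by rewrite -EFinB; congr EFin; lra.
have muS : (mu \x mu)%E S = ((4 * a)%:E * (4 * a)%:E)%E.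
  transitivity (mu (I m.1) * mu (I m.2))%E; last by rewrite !muI.
  by apply: product_measure1E; exact: measurable_itv.
rewrite integral_indic// setIT [X in (_ * X)%E](_ : _ = (4 * a)%:E * (4 * a)%:E)%E; last exact: muS.
rewrite -!EFinM lee_fin le_eqVlt; apply/orP; left; apply/eqP.
by field; rewrite gt_eqF.
Qed.

End ModulusUpperBound.

(** * The boundary of a square *)

Section SquarePath.
Context {R : realType}.
Variable t : R.

(** The boundary of the square of half-side [t] centred at the origin, run through
    at unit speed from and to the corner [(t, - t)]. *)
Definition square_path (v : R) : R * R :=
  if v <= 2 * t then (t, v - t) else
  if v <= 4 * t then (3 * t - v, t) else
  if v <= 6 * t then (- t, 5 * t - v) else (v - 7 * t, - t).

Local Notation P := square_path.

Lemma square_path1 (v : R) : v <= 2 * t -> P v = (t, v - t).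
Proof. by rewrite /P => ->. Qed.

Lemma square_path2 (v : R) : 2 * t <= v -> v <= 4 * t -> P v = (3 * t - v, t).
Proof.
rewrite le_eqVlt /P => /predU1P[<- _|v2 ->]; last by rewrite leNgt v2.
by rewrite lexx; congr (_, _); ring.
Qed.

Lemma square_path3 (v : R) : 0 < t -> 4 * t <= v -> v <= 6 * t -> P v = (- t, 5 * t - v).
Proof.
move=> t0; rewrite le_eqVlt => /predU1P[<- _|v4 v6].
  by rewrite square_path2; [congr (_, _); ring|lra..].
by rewrite /P v6 !leNgt v4 (lt_trans _ v4)//=; lra.
Qed.

Lemma square_path4 (v : R) : 0 < t -> 6 * t <= v -> P v = (v - 7 * t, - t).
Proof.
move=> t0; rewrite le_eqVlt => /predU1P[<-|v6].
  by rewrite square_path3; [congr (_, _); ring|lra..].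
by rewrite /P !leNgt v6 !(lt_trans _ v6)//=; lra.
Qed.

Lemma cmod_fst0 (x : R) (z w : R * R) : z.1 = w.1 -> z.2 - w.2 = x ->
  cmod (z - w) = `|x|.
Proof.
by move=> h <-; rewrite /cmod /= h subrr expr0n add0r sqrtr_sqr.
Qed.

Lemma cmod_snd0 (x : R) (z w : R * R) : z.1 - w.1 = x -> z.2 = w.2 ->
  cmod (z - w) = `|x|.
Proof.
by move=> <- h; rewrite /cmod /= h subrr expr0n addr0 sqrtr_sqr.
Qed.

Lemma square_path_side (i : nat) (x y : R) : 0 < t -> (i < 4)%N ->
  2 * t * i%:R <= x <= 2 * t * i.+1%:R -> 2 * t * i%:R <= y <= 2 * t * i.+1%:R ->
  cmod (P x - P y) = `|x - y|.
Proof.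
move=> t0; case: i => [|[|[|[|//]]]] _ /andP[x1 x2] /andP[y1 y2].
- rewrite !square_path1; [|lra..].
  by apply: cmod_fst0 => //=; lra.
- rewrite !square_path2; [|lra..].
  by rewrite -normrN; apply: cmod_snd0 => //=; lra.
- rewrite !square_path3; [|lra..].
  by rewrite -normrN; apply: cmod_fst0 => //=; lra.
- rewrite !square_path4; [|lra..].
  by apply: cmod_snd0 => //=; lra.
Qed.

Lemma square_path_lipschitz (u v : R) : 0 < t -> 0 <= u <= 8 * t -> 0 <= v <= 8 * t ->
  cmod (P v - P u) <= `|v - u|.
Proof.
move=> t0; suff H (i : nat) : (i <= 4)%N -> forall u v, 0 <= u -> u <= v -> v <= 2 * t * i%:R ->
    cmod (P v - P u) <= v - u.
  have H4 := H 4 isT.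
  move=> /andP[u0 u8] /andP[v0 v8]; case/orP: (le_total u v) => uv.
    by rewrite ger0_norm ?subr_ge0// H4//; lra.
  by rewrite cmodC distrC ger0_norm ?subr_ge0// H4//; lra.
elim: i => [_ {}u {}v|i ih i4 {}u {}v] u0 uv vi.
  have -> : v = u by lra.
  by rewrite !subrr cmod0.
have [vi'|iv] := leP v (2 * t * i%:R); first by apply: ih => //; exact: ltnW.
have [ui|iu] := leP u (2 * t * i%:R); last first.
  rewrite (square_path_side t0 i4) ?ger0_norm ?subr_ge0//.
    by rewrite (ltW iv).
  by rewrite (ltW iu) (le_trans uv).
have -> : v - u = (v - 2 * t * i%:R) + (2 * t * i%:R - u) by ring.
apply: le_trans (cmod_dist_triangle _ (P (2 * t * i%:R)) _) _; apply: lerD.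
  rewrite (square_path_side t0 i4) ?ger0_norm ?subr_ge0 ?(ltW iv)//.
  by rewrite lexx (le_trans (ltW iv) vi).
by apply: ih => //; exact: ltnW.
Qed.

(** A corner is the end of a side in both directions, so the path runs straight away
    from each of its points, forwards ([s = 1]) and backwards ([s = -1]), even though
    it is not an isometry near a corner. *)
Lemma square_path_straight (s v : R) : 0 < t -> s = 1 \/ s = -1 ->
  0 <= v <= 8 * t -> exists2 d, 0 < d & forall h, 0 <= h <= d ->
  0 <= v + s * h <= 8 * t -> cmod (P (v + s * h) - P v) = h.
Proof.
move=> t0; have H (i : nat) (h : R) : (i < 4)%N -> s = 1 \/ s = -1 -> 0 <= h ->
    2 * t * i%:R <= v <= 2 * t * i.+1%:R ->
    2 * t * i%:R <= v + s * h <= 2 * t * i.+1%:R -> cmod (P (v + s * h) - P v) = h.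
  move=> i4 s1 h0 vi vhi; rewrite (square_path_side t0 i4)// addrC addKr.
  by case: s1 => ->; rewrite ?mul1r ?mulN1r ?normrN ger0_norm.
move=> s1 v8.
have [v2|v2] := ltP v (2 * t); [|have [v4|v4] := ltP v (4 * t);
  [|have [v6|v6] := ltP v (6 * t)]]; case: (s1) => sE; rewrite sE in H *.
- exists (2 * t - v); first lra.
  by move=> h /andP[h0 hd] _; apply: (H 0) => //; [left|lra|lra].
- have [v0|v0] := eqVneq v 0.
    exists 1 => // h /andP[h0 hd]; rewrite v0 => ?.
    have -> : h = 0 by lra.
    by rewrite mulr0 addr0 subrr cmod0.
  have vgt0 : 0 < v by rewrite lt_neqAle eq_sym v0; case/andP: v8.
  exists v => // h /andP[h0 hd] _; apply: (H 0) => //; [by right|lra|lra].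
- exists (4 * t - v); first lra.
  by move=> h /andP[h0 hd] _; apply: (H 1) => //; [left|lra|lra].
- have [v2'|v2'] := eqVneq v (2 * t).
    exists v; first lra.
    by move=> h /andP[h0 hd] _; apply: (H 0) => //; [right|lra|lra].
  have vgt : 2 * t < v by rewrite lt_neqAle eq_sym v2'.
  exists (v - 2 * t); first lra.
  by move=> h /andP[h0 hd] _; apply: (H 1) => //; [right|lra|lra].
- exists (6 * t - v); first lra.
  by move=> h /andP[h0 hd] _; apply: (H 2) => //; [left|lra|lra].
- have [v2'|v2'] := eqVneq v (4 * t).
    exists (v - 2 * t); first lra.
    by move=> h /andP[h0 hd] _; apply: (H 1) => //; [right|lra|lra].
  have vgt : 4 * t < v by rewrite lt_neqAle eq_sym v2'.
  exists (v - 4 * t); first lra.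
  by move=> h /andP[h0 hd] _; apply: (H 2) => //; [right|lra|lra].
- have [v8'|v8'] := eqVneq v (8 * t).
    exists 1 => // h /andP[h0 hd]; rewrite v8' => ?.
    have -> : h = 0 by lra.
    by rewrite mulr0 addr0 subrr cmod0.
  have vlt : v < 8 * t by rewrite lt_neqAle v8'; case/andP: v8.
  exists (8 * t - v); first lra.
  by move=> h /andP[h0 hd] _; apply: (H 3) => //; [left|lra|lra].
- have [v2'|v2'] := eqVneq v (6 * t).
    exists (v - 4 * t); first lra.
    by move=> h /andP[h0 hd] _; apply: (H 2) => //; [right|lra|lra].
  have vgt : 6 * t < v by rewrite lt_neqAle eq_sym v2'.
  exists (v - 6 * t); first lra.
  by move=> h /andP[h0 hd] _; apply: (H 3) => //; [right|lra|lra].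
Qed.

Lemma square_path_onto (z : R * R) : 0 < t -> `|z| = t ->
  exists2 v, 0 <= v <= 8 * t & P v = z.
Proof.
move=> t0; case: z => x y; rewrite supnormE /= => zt.
have : `|x| <= t /\ `|y| <= t by rewrite -zt !le_max !lexx orbT.
rewrite !ler_norml => -[xt yt].
have : [\/ x = t, x = - t, y = t | y = - t].
  move: zt; rewrite /Num.max; case: ifP => _ <-.
    by case: (ger0P y) => _; [apply: Or43|apply: Or44; rewrite opprK].
  by case: (ger0P x) => _; [apply: Or41|apply: Or42; rewrite opprK].
case=> E; rewrite E.
- exists (y + t); first lra.
  by rewrite square_path1; [congr (_, _); ring|lra].
- exists (5 * t - y); first lra.
  by rewrite square_path3; [congr (_, _); ring|lra..].
- exists (3 * t - x); first lra.
  by rewrite square_path2; [congr (_, _); ring|lra..].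
- exists (x + 7 * t); first lra.
  by rewrite square_path4; [congr (_, _); ring|lra..].
Qed.

(** A point of the square having a nonnegative inner product with the centre, such as
    the corner in the quadrant of the centre, is farther from the origin than the
    centre. *)
Lemma square_path_exit (a : R * R) : 0 < t -> cmod a = 1 ->
  exists2 v, 0 <= v <= 8 * t & 1 <= cmod (a + P v).
Proof.
move=> t0 a1; have a2 := sqr_cmod a; rewrite a1 expr1n in a2.
suff [v v8 Pv] : exists2 v, 0 <= v <= 8 * t &
    0 <= a.1 * (P v).1 + a.2 * (P v).2.
  exists v => //; rewrite -ler_sqr ?nnegrE ?cmod_ge0// expr1n sqr_cmod /=.
  have := sqr_ge0 (P v).1; have := sqr_ge0 (P v).2; nra.
have [x0|x0] := leP 0 a.1; have [y0|y0] := leP 0 a.2.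
- exists (2 * t); first lra.
  by rewrite square_path1//=; nra.
- exists 0; first lra.
  by rewrite square_path1/=; nra.
- exists (4 * t); first lra.
  by rewrite square_path2/=; nra.
- exists (6 * t); first lra.
  by rewrite square_path3/=; nra.
Qed.

End SquarePath.

(** * Arcs of squares as curves *)

Section SquareArc.
Context {R : realType}.
Local Notation mu := (@lebesgue_measure R).

(** The piece of length [l] of the boundary of the square centred at [a] that
    starts at parameter [v], in the direction [s]. It stays at its ends outside
    of [0, 1], so that all its values lie on the arc. *)
Definition square_arc (a : R * R) (t v s l tau : R) : R * R :=
  a + square_path t (v + s * (l * clamp 1 tau)).

Variables (a : R * R) (t v s l : R).
Hypotheses (t0 : 0 < t) (s1 : s = 1 \/ s = -1) (l0 : 0 <= l).
Hypotheses (v8 : 0 <= v <= 8 * t) (vl8 : 0 <= v + s * l <= 8 * t).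
Local Notation c := (square_arc a t v s l).

Lemma square_arcE tau : 0 <= tau <= 1 -> c tau = a + square_path t (v + s * (l * tau)).
Proof. by move=> /clampE; rewrite /square_arc => ->. Qed.

Lemma square_arc_range u : 0 <= u <= l -> 0 <= v + s * u <= 8 * t.
Proof.
have [[l0' v8'] vl8'] := (l0, v8, vl8).
move=> ul; case: s1 => sE; rewrite sE in vl8' *; lra.
Qed.

Lemma square_arc_lipschitz :
  {in `[0, 1] &, forall x y : R, cmod (c x - c y) <= l * `|x - y|}.
Proof.
have lu u : 0 <= u <= 1 -> 0 <= l * u <= l.
  by move=> /andP[u0 u1]; rewrite mulr_ge0//= ler_piMr.
move=> x y; rewrite !in_itv/= => x01 y01; rewrite !square_arcE//.
rewrite opprD addrACA subrr add0r.
apply: le_trans (square_path_lipschitz t0 _ _) _; try exact/square_arc_range/lu.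
rewrite opprD addrACA subrr add0r -mulrBr -mulrBr !normrM (ger0_norm l0).
by case: s1 => ->; rewrite ?normrN normr1 mul1r.
Qed.

Lemma square_arc_length tau : 0 <= tau <= 1 -> arc_length 0 tau c = (l * tau)%:E.
Proof.
apply: (arc_length_constant_speed l0 square_arc_lipschitz) => x /andP[x0 x1].
have lx : 0 <= l * x <= l by rewrite mulr_ge0//= ler_piMr// ltW.
have [d d0 hd] := square_path_straight t0 s1 (square_arc_range lx).
have l1 : 0 < l + 1 by rewrite ltr_wpDl.
(* the denominator [l + 1] covers the constant arc, where [l = 0] *)
exists (d / (l + 1)); first by rewrite divr_gt0.
move=> y /andP[xy yd] y1; rewrite !square_arcE ?(le_trans x0 xy)// ?x0 ?(ltW x1)//.
rewrite opprD addrACA subrr add0r.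
have -> : v + s * (l * y) = v + s * (l * x) + s * (l * (y - x)) by ring.
apply: hd.
  rewrite mulr_ge0 ?subr_ge0//= (@le_trans _ _ (l * (d / (l + 1))))//.
    by rewrite ler_wpM2l// lerBlDl.
  by rewrite mulrCA ler_piMr ?(ltW d0)// ler_pdivrMr// mul1r lerDl.
have -> : v + s * (l * x) + s * (l * (y - x)) = v + s * (l * y) by ring.
by apply: square_arc_range; rewrite mulr_ge0 ?(le_trans x0 xy)//= ler_piMr.
Qed.

Lemma square_arc_continuous : continuous c.
Proof.
move=> x; apply/cvgrPdist_lt => e e0.
have l1 : 0 < l + 1 by rewrite ltr_wpDl.
have el : 0 < e / (l + 1) by rewrite divr_gt0.
near=> y; apply: le_lt_trans (supnorm_le_cmod _) _.
have ck z : c z = c (clamp 1 z) by rewrite /square_arc (clampE (clamp_itv z ler01)).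
rewrite ck (ck y); apply: le_lt_trans (square_arc_lipschitz _ _) _;
  rewrite ?in_itv/= ?clamp_itv//.
have xy : `|x - y| < e / (l + 1) by near: y; exact: cvgr_dist_lt.
apply: (@le_lt_trans _ _ (l * (e / (l + 1)))).
  by rewrite ler_wpM2l// (le_trans (clamp_lipschitz _ _ _))// ltW.
by rewrite mulrA ltr_pdivrMr// mulrDr mulr1 (mulrC l) ltrDl.
Unshelve. all: by end_near. Qed.

Lemma square_arc_in (D : set (R * R)) :
  (forall u, 0 <= u <= l -> D (a + square_path t (v + s * u))) -> forall tau, D (c tau).
Proof.
move=> hD tau; apply: hD; have /andP[h0 h1] := clamp_itv tau ler01.
by rewrite mulr_ge0//= ler_piMr.
Qed.

Lemma square_arc_param u : 0 < l -> 0 <= u <= l ->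
  arc_param c u = a + square_path t (v + s * u).
Proof.
move=> lgt0 /andP[u0 ul].
rewrite (arc_param_constant_speed lgt0 square_arc_length) ?u0//.
rewrite square_arcE ?divr_ge0//=; last by rewrite ler_pdivrMr// mul1r.
by rewrite [l * _]mulrC divfK ?gt_eqF.
Qed.

End SquareArc.

(** * The length-area method on squares *)

Section SquareEnergy.
Context {R : realType}.
Local Notation mu := (@lebesgue_measure R).
Variable g : R * R -> \bar R.
Hypotheses (mg : measurable_fun [set: measurableTypeR R * measurableTypeR R] g)
           (g0 : forall z, (0 <= g z)%E).

Let G (z : R * R) : \bar R := (g z ^+ 2)%E.

Let G0 z : (0 <= G z)%E.
Proof. exact: expe_ge0. Qed.

Let mG : measurable_fun [set: measurableTypeR R * measurableTypeR R] G.
Proof. by rewrite /G; under eq_fun do rewrite expe2; exact: emeasurable_funM. Qed.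

Definition vertical_energy (x : R) : \bar R := (\int[mu]_y (g (x, y) ^+ 2))%E.
Definition horizontal_energy (y : R) : \bar R := (\int[mu]_x (g (x, y) ^+ 2))%E.

(** The energy on the four lines that contain the sides of the square of half-side
    [t] centred at [a], in the form to which [ge0_integral_reflect] applies. *)
Definition cross_energy (a : R * R) (t : R) : \bar R :=
  (vertical_energy (a.1 + 1 * t)%R + vertical_energy (a.1 + -1 * t)%R +
   (horizontal_energy (a.2 + 1 * t)%R + horizontal_energy (a.2 + -1 * t)%R))%E.

Let measurable_vertical x : measurable_fun [set: measurableTypeR R] (fun y => G (x, y)).
Proof. exact: (measurable_fun_pair2 x mG). Qed.

Let measurable_horizontal y : measurable_fun [set: measurableTypeR R] (fun x => G (x, y)).
Proof. exact: (measurable_fun_pair1 y mG). Qed.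

Lemma vertical_energyE x b s : s = 1 \/ s = -1 ->
  vertical_energy x = (\int[mu]_u G (x, (b + s * u)%R))%E.
Proof.
move=> s1; symmetry.
exact: (@ge0_integralT_affine _ b s s1 (fun y => G (x, y)) (measurable_vertical x)).
Qed.

Lemma horizontal_energyE y b s : s = 1 \/ s = -1 ->
  horizontal_energy y = (\int[mu]_u G ((b + s * u)%R, y))%E.
Proof.
move=> s1; symmetry.
exact: (@ge0_integralT_affine _ b s s1 (fun x => G (x, y)) (measurable_horizontal y)).
Qed.

Let measurable_vertical_affine x b s :
  measurable_fun [set: measurableTypeR R] (fun u => G (x, (b + s * u)%R)).
Proof. exact: (measurable_comp_affine b s (measurable_vertical x)). Qed.

Let measurable_horizontal_affine y b s :
  measurable_fun [set: measurableTypeR R] (fun u => G ((b + s * u)%R, y)).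
Proof. exact: (measurable_comp_affine b s (measurable_horizontal y)). Qed.

(** The difference of the two sides is a multiple of [(8 * k * x - 1) ^+ 2]. *)
Let amgm (k : R) (x : \bar R) : 0 < k -> (0 <= x)%E ->
  (x <= (4 * k)%:E * (x ^+ 2) + (16 * k)^-1%:E)%E.
Proof.
move=> k0; case: x => [x| |]//= x0; last first.
  by rewrite mulyy gt0_muley ?lte_fin ?mulr_gt0// addye.
rewrite -!EFinM -EFinD lee_fin.
rewrite -subr_ge0; have -> : 4 * k * (x * x) + (16 * k)^-1 - x =
    (16 * k)^-1 * (8 * k * x - 1) ^+ 2 by field; rewrite gt_eqF.
by rewrite mulr_ge0 ?sqr_ge0// invr_ge0 mulr_ge0// ltW.
Qed.

(** Arithmetic-geometric form of the length-area inequality: the length of the arc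
    is at most [8 * t], so a metric giving it length at least 1 has energy at least
    [1 / (8 * t)] on it; the four lines containing the sides of the square carry at
    least as much. *)
Lemma cross_energy_ge (a : R * R) (t v s l : R) : 0 < t -> s = 1 \/ s = -1 -> 0 <= l ->
  0 <= v <= 8 * t -> 0 <= v + s * l <= 8 * t ->
  (1 <= line_integral g (square_arc a t v s l))%E ->
  ((8 * t)^-1%:E <= cross_energy a t)%E.
Proof.
move=> t0 s1 l0 v8 vl8.
have cT : curve_in [set: R * R] (square_arc a t v s l).
  by split=> //; apply/continuous_subspaceT/square_arc_continuous.
have lE : arc_length 0 1 (square_arc a t v s l) = l%:E.
  by rewrite square_arc_length ?mulr1 ?ler01 ?lexx.
have rc : rectifiable (square_arc a t v s l) by rewrite /rectifiable lE ltry.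
have [L [k [[_ LE kl] [_ _ _ kE ->]]]] := line_integral_lipschitz1 cT rc.
move: LE; rewrite lE => -[lL]; rewrite -{}lL in kE *.
move: l0; rewrite le_eqVlt => /predU1P[<-|l0].
  by rewrite set_itv1 integral_set1 lee_fin ler10.
have l8 : l <= 8 * t by case: s1 => sE; rewrite sE in vl8; lra.
(* on each side of the square one of the four terms is the energy density of [g] at
   the point of the arc of parameter [u] *)
pose E u := (G ((a.1 + 1 * t)%R, (a.2 - t + v + s * u)%R) +
             G ((a.1 + -1 * t)%R, (a.2 + 5 * t - v + - s * u)%R) +
            (G ((a.1 + 3 * t - v + - s * u)%R, (a.2 + 1 * t)%R) +
             G ((a.1 - 7 * t + v + s * u)%R, (a.2 + -1 * t)%R)))%E.
have E0 u : (0 <= E u)%E by rewrite !adde_ge0.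
have mE : measurable_fun [set: measurableTypeR R] E.
  by apply: emeasurable_funD; apply: emeasurable_funD.
have Ek u : 0 <= u <= l -> (G (k u) <= E u)%E.
  move=> ul; rewrite kE// square_arc_param ?(ltW l0)//.
  have := square_arc_range s1 (ltW l0) v8 vl8 ul; rewrite /E.
  set w := v + s * u => w8.
  have [w2|w2] := leP w (2 * t).
    rewrite square_path1//; apply: le_trans (leeDl _ _); last by rewrite adde_ge0.
    apply: le_trans (leeDl _ _) => //; rewrite le_eqVlt; apply/orP; left; apply/eqP.
    by congr (G (_, _)); rewrite /= /w; ring.
  have [w4|w4] := leP w (4 * t).
    rewrite square_path2 ?(ltW w2)//; apply: le_trans (leeDr _ _); last by rewrite adde_ge0.
    apply: le_trans (leeDl _ _) => //; rewrite le_eqVlt; apply/orP; left; apply/eqP.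
    by congr (G (_, _)); rewrite /= /w; ring.
  have [w6|w6] := leP w (6 * t).
    rewrite square_path3 ?(ltW w4)//; apply: le_trans (leeDl _ _); last by rewrite adde_ge0.
    apply: le_trans (leeDr _ _) => //; rewrite le_eqVlt; apply/orP; left; apply/eqP.
    by congr (G (_, _)); rewrite /= /w; ring.
  rewrite square_path4 ?(ltW w6)//; apply: le_trans (leeDr _ _); last by rewrite adde_ge0.
  apply: le_trans (leeDr _ _) => //; rewrite le_eqVlt; apply/orP; left; apply/eqP.
  by congr (G (_, _)); rewrite /= /w; ring.
have sN : - s = 1 \/ - s = -1 by case: s1 => ->; [right|left; rewrite opprK].
have EC : (\int[mu]_(u in `[0%R, l]) E u <= cross_energy a t)%E.
  apply: (@le_trans _ _ (\int[mu]_u E u)%E).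
    by apply: ge0_subset_integral.
  rewrite /cross_energy (vertical_energyE _ (a.2 - t + v) s1).
  rewrite (vertical_energyE _ (a.2 + 5 * t - v) sN).
  rewrite (horizontal_energyE _ (a.1 + 3 * t - v) sN).
  rewrite (horizontal_energyE _ (a.1 - 7 * t + v) s1).
  rewrite -!ge0_integralD//; try (by move=> *; rewrite adde_ge0).
  - exact: emeasurable_funD.
  - exact: emeasurable_funD.
move=> g1.
have {g1} : (1 <= (4 * t)%:E * cross_energy a t + 2^-1%:E)%E.
  apply: le_trans g1 _.
  apply: (@le_trans _ _ (\int[mu]_(u in `[0%R, l]) ((4 * t)%:E * E u + (16 * t)^-1%:E))%E).
    apply: ge0_le_integral => //.
    - apply: measurable_funTS; apply: measurableT_comp => //; exact: lipschitz1_measurable.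
    - apply: measurable_funTS; apply: emeasurable_funD => //.
      exact: measurable_funeM.
    move=> u; rewrite /= in_itv/= => ul; apply: le_trans (amgm t0 (g0 _)) _.
    apply: leeD2r; apply: lee_wpmul2l; first by rewrite lee_fin mulr_ge0// ltW.
    exact: Ek.
  rewrite ge0_integralD//; last 3 first.
  - by move=> u _; rewrite mule_ge0// lee_fin mulr_ge0// ltW.
  - by apply: measurable_funTS; exact: measurable_funeM.
  - by move=> u _; rewrite lee_fin invr_ge0 mulr_ge0// ltW.
  rewrite ge0_integralZl_EFin//; last 2 first.
  - exact: measurable_funTS.
  - by rewrite mulr_ge0// ltW.
  apply: leeD.
    by apply: lee_wpmul2l => //; rewrite lee_fin mulr_ge0// ltW.
  rewrite integral_cst_segment ?subr0 ?(ltW l0)// lee_fin.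
  rewrite mulrC ler_pdivrMr ?mulr_gt0//; lra.
case: (cross_energy a t) => [x| |]; rewrite ?leey//.
- rewrite -EFinM -EFinD !lee_fin => h.
  rewrite -[(8 * t)^-1]mul1r ler_pdivrMr ?mulr_gt0//; lra.
- by rewrite gt0_muleNy ?lte_fin ?mulr_gt0.
Qed.

Let measurable_vertical_energy :
  measurable_fun [set: measurableTypeR R] vertical_energy.
Proof. exact: (measurable_fun_fubini_tonelli_F (m2 := mu) G mG G0). Qed.

Let measurable_horizontal_energy :
  measurable_fun [set: measurableTypeR R] horizontal_energy.
Proof. exact: (measurable_fun_fubini_tonelli_G (m1 := mu) G mG G0). Qed.

Let vertical_energy_ge0 x : (0 <= vertical_energy x)%E.
Proof. by apply: integral_ge0 => y _; exact: G0. Qed.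

Let horizontal_energy_ge0 y : (0 <= horizontal_energy y)%E.
Proof. by apply: integral_ge0 => x _; exact: G0. Qed.

Let total_vertical :
  (\int[mu]_t vertical_energy t = \int[mu \x mu]_z (g z ^+ 2))%E.
Proof. by rewrite (fubini_tonelli1 (m1 := mu) (m2 := mu) G mG G0). Qed.

Let total_horizontal :
  (\int[mu]_t horizontal_energy t = \int[mu \x mu]_z (g z ^+ 2))%E.
Proof. by rewrite (fubini_tonelli2 (m1 := mu) (m2 := mu) G mG G0). Qed.

(** As [t] varies, each of the four lines sweeps a part of the plane at most once, so
    by Tonelli the integral of the energy on them is at most four times the energy in
    the plane, while [1 / (8 * t)] integrates to a logarithm. *)
Lemma energy_ge_ln (a : R * R) (t1 t2 : R) : 0 < t1 -> t1 <= t2 ->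
  (forall t, t1 <= t <= t2 -> ((8 * t)^-1%:E <= cross_energy a t)%E) ->
  (((ln t2 - ln t1) / 32)%:E <= \int[mu \x mu]_z (g z ^+ 2))%E.
Proof.
move=> t10 t12 h.
have mV := measurable_comp_affine _ _ measurable_vertical_energy.
have mH := measurable_comp_affine _ _ measurable_horizontal_energy.
have mC : measurable_fun [set: measurableTypeR R] (cross_energy a).
  by apply: emeasurable_funD; apply: emeasurable_funD; [exact: mV..|exact: mH|exact: mH].
have C0 t : (0 <= cross_energy a t)%E by apply: adde_ge0; apply: adde_ge0.
set E := (\int[mu \x mu]_z (g z ^+ 2))%E.
have CE : (\int[mu]_t cross_energy a t = E + E + (E + E))%E.
  rewrite /cross_energy ge0_integralD//.
  - rewrite (ge0_integral_reflect a.1 measurable_vertical_energy)//.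
    rewrite (ge0_integral_reflect a.2 measurable_horizontal_energy)//.
    by rewrite total_vertical total_horizontal.
  - by move=> t _; apply: adde_ge0; exact: vertical_energy_ge0.
  - by apply: emeasurable_funD; exact: mV.
  - by move=> t _; apply: adde_ge0; exact: horizontal_energy_ge0.
  - by apply: emeasurable_funD; exact: mH.
have : (((ln t2 - ln t1) / 8)%:E <= E + E + (E + E))%E.
  rewrite -CE; apply: (@le_trans _ _ (\int[mu]_(t in `[t1, t2]) cross_energy a t)%E); last first.
    exact: ge0_subset_integral.
  have mi : measurable_fun `[t1, t2] (fun t : measurableTypeR R => (t^-1)%:E).
    apply/measurable_EFinP; apply: subspace_continuous_measurable_fun => //.
    apply: continuous_in_subspaceT => t; rewrite inE/= in_itv/= => /andP[t1t _].
    by apply: inv_continuous; rewrite gt_eqF// (lt_le_trans t10).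
  apply: (@le_trans _ _ (\int[mu]_(t in `[t1, t2]) (8^-1%:E * (t^-1)%:E))%E).
    rewrite ge0_integralZl_EFin ?invr_ge0//.
      by rewrite integral_inv// -EFinM mulrC.
    move=> t; rewrite /= in_itv/= => /andP[t1t _].
    by rewrite lee_fin invr_ge0 (le_trans (ltW t10)).
  apply: ge0_le_integral => //.
  - move=> t; rewrite /= in_itv/= => /andP[t1t _].
    by rewrite -EFinM lee_fin mulr_ge0// invr_ge0 (le_trans (ltW t10)).
  - exact: measurable_funeM.
  - exact: measurable_funTS.
  by move=> t; rewrite /= in_itv/= => tt; rewrite -EFinM -invfM; exact: h.
have : (0 <= E)%E by apply: integral_ge0 => z _; exact: G0.
case: E {CE} => [e| |]; [|by move=> _ _; exact: leey|by []].
by rewrite -!EFinD !lee_fin => _; lra.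
Qed.

End SquareEnergy.

(** * Arcs of squares leaving a compact subset of the disk *)

Section Homeomorphism.
Context {R : realType}.
Local Notation D := (@unit_disk R).

Lemma self_homeomorphism_inverse (f : R * R -> R * R) : self_homeomorphism D f ->
  exists g : R * R -> R * R,
    [/\ forall x, D x -> D (f x) /\ g (f x) = x,
        forall y, D y -> D (g y) /\ f (g y) = y,
        forall x, D x -> {for x, continuous f} &
        forall y, D y -> {for y, continuous g}].
Proof.
move=> [g [fD gD fK [cf cg]]]; exists g.
have fDD x : D x -> D (f x) by move=> Dx; rewrite -fD; exists x.
have gDD x : D x -> D (g x) by move=> Dx; rewrite -gD; exists x.
have gfK x : D x -> g (f x) = x by move=> Dx; apply: fK; rewrite inE.
split=> [x Dx|y Dy|x Dx|x Dx].
- by split; [exact: fDD|exact: gfK].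
- split; first exact: gDD.
  by move: Dy; rewrite -{1}fD => -[x Dx <-]; rewrite gfK.
- move: cf; rewrite (continuous_open_subspace f open_unit_disk) => cf.
  exact: cf (mem_set Dx).
- move: cg; rewrite (continuous_open_subspace g open_unit_disk) => cg.
  exact: cg (mem_set Dx).
Qed.

Lemma first_hit (psi : R -> R) (l r : R) : 0 <= l ->
  (forall u v, 0 <= u <= l -> 0 <= v <= l -> `|psi u - psi v| <= `|u - v|) ->
  psi 0 < r -> r <= psi l ->
  exists2 l', 0 <= l' <= l & psi l' = r /\ forall u, 0 <= u <= l' -> psi u <= r.
Proof.
move=> l0 lip p0 pl; pose S := [set u | 0 <= u <= l /\ r <= psi u].
have Sl : S l by split; rewrite ?lexx ?l0.
have lbS : lbound S 0 by move=> u [/andP[]].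
have infS : has_inf S by split; [exists l|exists 0].
have T0 : 0 <= inf S by apply: lb_le_inf => //; exists l.
have Tl : inf S <= l by apply: ge_inf => //; exists 0.
have below u : 0 <= u -> u < inf S -> psi u < r.
  move=> u0 uT; rewrite ltNge; apply/negP => ru.
  have : inf S <= u by apply: ge_inf; [exists 0|split=> //; rewrite u0 (le_trans (ltW uT))].
  by rewrite leNgt uT.
have rT : r <= psi (inf S).
  apply/ler_addgt0Pr => e e0; have [u Su uT] := inf_adherent e0 infS.
  case: (Su) => u0l ru; have Tu : inf S <= u by apply: ge_inf => //; exists 0.
  have := lip u (inf S) u0l; rewrite T0 Tl => /(_ isT).
  rewrite (ger0_norm (_ : 0 <= u - inf S)) ?subr_ge0// ler_norml => /andP[_]; lra.
have Tr : psi (inf S) <= r.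
  apply/ler_addgt0Pr => e e0.
  have Tgt0 : 0 < inf S.
    by rewrite lt_neqAle T0 andbT; apply/negP => /eqP E; move: rT; rewrite -E leNgt p0.
  pose u := Num.max 0 (inf S - e).
  have u0 : 0 <= u by rewrite le_max lexx.
  have uT : u < inf S by rewrite gt_max Tgt0/= ltrBlDr ltrDl.
  have ue : inf S - e <= u by rewrite le_max lexx orbT.
  have := lip (inf S) u; rewrite T0 Tl u0 (le_trans (ltW uT) Tl) => /(_ isT isT).
  have := below u u0 uT.
  rewrite (ger0_norm (_ : 0 <= inf S - u)) ?subr_ge0 ?(ltW uT)// ler_norml.
  by move=> h /andP[_]; lra.
exists (inf S); first by rewrite T0.
split; first by apply/eqP; rewrite eq_le Tr.
move=> u /andP[u0]; rewrite le_eqVlt => /predU1P[->//|uT].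
by rewrite ltW// below.
Qed.

End Homeomorphism.

Section SquareCrossing.
Context {R : realType}.
Local Notation D := (@unit_disk R).
Variables f g : R * R -> R * R.
Hypothesis fP : forall x, D x -> D (f x) /\ g (f x) = x.
Hypothesis gP : forall y, D y -> D (g y) /\ f (g y) = y.
Hypothesis fc : forall x, D x -> {for x, continuous f}.
Hypothesis gc : forall y, D y -> {for y, continuous g}.

(** A square centred on the unit circle leaves the disk, and the image of a compact
    set stays away from the circle: following the square from a point of that image
    one meets, still inside the disk, a point outside of the image. *)
Lemma square_arc_leaving (C : set (R * R)) (e b : R * R) (t : R) :
  compact C -> C `<=` D -> D e -> C (g e) -> cmod b = 1 -> 0 < t -> `|e - b| = t ->
  exists v s l : R, [/\ s = 1 \/ s = -1, 0 <= l, 0 <= v <= 8 * t & 0 <= v + s * l <= 8 * t]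
    /\ [/\ b + square_path t v = e,
           forall u, 0 <= u <= l -> D (b + square_path t (v + s * u)) &
           ~ C (g (b + square_path t (v + s * l)))].
Proof.
move=> cC CD De Cge b1 t0 ebt.
have cmodf : {within C, continuous (cmod \o f)}.
  apply: continuous_in_subspaceT => z /set_mem /CD Dz.
  by apply: continuous_comp; [exact: fc|exact: cmod_continuous].
have [c Cc cmax] := compact_EVT_max (ex_intro _ _ Cge) cC cmodf.
have c1 : cmod (f c) < 1 by apply: (fP _).1; apply: CD; exact: set_mem.
have out z : D z -> (1 + cmod (f c)) / 2 <= cmod z -> ~ C (g z).
  move=> Dz rz Cgz; have := cmax (g z) (mem_set Cgz).
  by rewrite /= (gP Dz).2; lra.
have [v v8 ve] := square_path_onto t0 ebt.
have [v1 v18 v1out] := square_path_exit t0 b1.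
have [s [l [s1 l0 sl]]] : exists s l : R, [/\ s = 1 \/ s = -1, 0 <= l & v + s * l = v1].
  have [vv|vv] := leP v v1.
    by exists 1, (v1 - v); split; [left|rewrite subr_ge0|ring].
  by exists (-1), (v - v1); split; [right|rewrite subr_ge0 ltW|ring].
have vl8 : 0 <= v + s * l <= 8 * t by rewrite sl.
pose psi u := cmod (b + square_path t (v + s * u)).
have psi0 : psi 0 = cmod e by rewrite /psi mulr0 addr0 ve subrKC.
have e_le : cmod e <= cmod (f c).
  by have := cmax (g e) (mem_set Cge); rewrite /= (gP De).2.
have lip u w : 0 <= u <= l -> 0 <= w <= l -> `|psi u - psi w| <= `|u - w|.
  move=> ul wl; apply: le_trans (cmod_dist_dist _ _) _.
  rewrite opprD addrACA subrr add0r.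
  apply: le_trans (square_path_lipschitz t0 _ _) _; try exact: (square_arc_range s1 l0 v8 vl8).
  rewrite opprD addrACA subrr add0r -mulrBr normrM.
  by case: s1 => ->; rewrite ?normrN normr1 mul1r.
have [||l' /andP[l'0 l'l] [psil' psile]] := first_hit l0 lip (r := (1 + cmod (f c)) / 2).
- by rewrite psi0; lra.
- by rewrite /psi sl; apply: le_trans v1out; lra.
have Dl' u : 0 <= u <= l' -> D (b + square_path t (v + s * u)).
  by move=> /psile; rewrite /unit_disk/= /psi; lra.
exists v, s, l'; split; split=> //.
- by apply: (square_arc_range s1 l0 v8 vl8); rewrite l'0.
- by rewrite ve subrKC.
- by apply: out; [apply: Dl'; rewrite l'0 lexx|rewrite -psil'].
Qed.

End SquareCrossing.

(** * Distortion of quasiconformal maps *)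

Section LocalDistortion.
Context {R : realType}.
Local Notation D := (@unit_disk R).

(** A range of half-sides of ratio [expR (512 * K + 1)] would violate the modulus
    inequality: 512 is the product of the constants 32 of [energy_ge_ln] and 16 of
    [modulus_crossing_le]. The factor 2 pays for the comparison of the modulus with
    the sup norm, and the summand 1 for centring the squares on the circle. *)
Definition distortion (K : R) : R := 2 * (expR (512 * K + 1) + 1).

Lemma distortion_ge0 (K : R) : 0 <= distortion K.
Proof.
by apply: mulr_ge0; [exact: ler0n|apply: addr_ge0; [exact: expR_ge0|exact: ler01]].
Qed.

(** The sup norm may underestimate the modulus by a factor up to 2, so doubling a
    square of half-side [(1 - cmod m) / 5] gives points at distance at most
    [4 / 5 * (1 - cmod m)] from [m]. *)
Lemma small_square_sub_disk (m z : R * R) : D m ->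
  `|z - m| <= 2 * ((1 - cmod m) / 5) -> D z.
Proof.
rewrite /unit_disk/= => m1 zm; have h := cmod_le_supnorm (z - m).
have : cmod z <= cmod (z - m) + cmod m by rewrite (le_trans _ (cmod_triangle _ _))// subrK.
lra.
Qed.

Lemma segment_supnorm (m x y : R * R) (a tau : R) : `|x - m| <= a -> `|y - m| <= a ->
  0 <= tau <= 1 -> `|y + tau *: (x - y) - m| <= a.
Proof.
move=> xm ym /andP[t0 t1].
have -> : y + tau *: (x - y) - m = (1 - tau) *: (y - m) + tau *: (x - m).
  rewrite !scalerBr !scalerBl !scale1r.
  apply/eqP; rewrite -subr_eq0; apply/eqP.
  case: x y m {xm ym} => [x1 x2] [y1 y2] [m1 m2]; congr (_, _); rewrite /= /GRing.scale/=; ring.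
apply: le_trans (ler_normD _ _) _; rewrite !normrZ !ger0_norm ?subr_ge0//; nra.
Qed.

Lemma radial_projection (w : R * R) : 0 < cmod w -> cmod w < 1 ->
  exists2 b : R * R, cmod b = 1 & cmod (w - b) = 1 - cmod w.
Proof.
move=> w0 w1; exists ((cmod w)^-1 *: w).
  by rewrite cmodZ ger0_norm ?invr_ge0 ?(ltW w0)// mulVf ?gt_eqF.
rewrite -[X in X - _]scale1r -scalerBl cmodZ -{2}[cmod w]ger0_norm ?(ltW w0)//.
rewrite -normrM mulrBl mul1r mulVf ?gt_eqF// distrC ger0_norm// subr_ge0 ltW//.
Qed.

(** If the image points were far apart compared with the distance of one of them to
    the unit circle, squares centred at the boundary point next to it, of all
    half-sides in a long range, would cross the image of the segment joining the
    original points. The arcs of these squares running towards the circle would have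
    a large modulus, while they are images of curves crossing a square annulus. *)
Lemma qc_local_distortion (f : R * R -> R * R) (K : R) (m x y : R * R) :
  self_homeomorphism D f -> 1 <= K -> K_quasiconformal D K f -> D m ->
  `|x - m| <= (1 - cmod m) / 5 -> `|y - m| <= (1 - cmod m) / 5 ->
  cmod (f x - f y) <= distortion K * (1 - cmod (f y)).
Proof.
move=> hf K1 hK Dm; set a := (1 - cmod m) / 5 => xm ym.
have [g [fP gP fc gc]] := self_homeomorphism_inverse hf.
have a0 : 0 < a by rewrite divr_gt0// subr_gt0.
have inD z : `|z - m| <= 2 * a -> D z := small_square_sub_disk Dm.
have inD1 z : `|z - m| <= a -> D z by move=> zm; apply: inD; lra.
have /fP[Dfx _] := inD1 x xm; have /fP[Dfy _] := inD1 y ym.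
rewrite leNgt; apply/negP => big.
set w := f y in Dfy big; pose d := 1 - cmod w.
have d0 : 0 < d by rewrite subr_gt0.
pose e := expR (512 * K + 1).
have e1 : 1 <= e by rewrite -expR0 ler_expR; lra.
have big' : 2 * (e + 1) * d < cmod (f x - w) by [].
have w0 : 0 < cmod w.
  have : cmod (f x - w) < 2.
    apply: le_lt_trans (cmod_triangle _ _) _; rewrite cmodN.
    by have : cmod (f x) < 1 := Dfx; have : cmod w < 1 := Dfy; lra.
  by move: d0 big'; rewrite /d; nra.
have [b b1 wb] := radial_projection w0 Dfy.
pose sigma tau := y + tau *: (x - y).
have sm tau : 0 <= tau <= 1 -> `|sigma tau - m| <= a := segment_supnorm xm ym.
(* squares of half-side at least [t1] contain [w], and by [cmod_le_supnorm] those of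
   half-side at most [t2] do not contain [f x] in their interior *)
pose t1 := d; pose t2 := cmod (f x - w) / 2 - d.
have et2 : e * t1 < t2 by rewrite /t1 /t2; lra.
have t12 : t1 <= t2 by rewrite (le_trans _ (ltW et2))// ler_peMl// ltW.
have t20 : 0 < t2 := lt_le_trans d0 t12.
pose G := [set c : R -> R * R | [/\ curve_in D c,
   (exists2 tau, 0 <= tau <= 1 & c 0 = sigma tau) & 2 * a <= `|c 1 - m|]].
have GD : G `<=` curve_in D by move=> c [].
have G16 : (modulus G <= 16%:E)%E.
  apply: (modulus_crossing_le a0 (m := m)) => c [[cc _] [tau t01 c0] c1]; split=> //.
  by rewrite c0; exact: sm.
have up : (modulus [set f \o c | c in G] <= (K * 16)%:E)%E.
  apply: le_trans (hK _ GD).2 _; rewrite EFinM; apply: lee_wpmul2l => //.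
  by rewrite lee_fin (le_trans ler01).
have low : (((ln t2 - ln t1) / 32)%:E <= modulus [set f \o c | c in G])%E.
  apply: le_ereal_inf_tmp => _ [h [mh h0 hadm] <-].
  apply: (energy_ge_ln mh h0 (a := b) d0 t12) => t /andP[tt1 tt2].
  have t0 : 0 < t := lt_le_trans d0 tt1.
  pose phi tau := `|f (sigma tau) - b|.
  have phic : {within `[0, 1], continuous phi}.
    apply: continuous_in_subspaceT => tau; rewrite inE/= in_itv/= => t01.
    apply: cvg_norm; apply: cvgB; last exact: cvg_cst.
    apply: (@continuous_comp _ _ _ sigma f); last by apply: fc; apply: inD1; exact: sm.
    by apply: cvgD; [exact: cvg_cst|apply: cvgZr_tmp; exact: cvg_id].
  have phi0 : phi 0 <= t.
    rewrite /phi /sigma scale0r addr0; apply: le_trans (supnorm_le_cmod _) _.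
    by rewrite wb.
  have phi1 : t <= phi 1.
    rewrite /phi /sigma scale1r subrKC.
    have h3 : `|f x - w| <= `|f x - b| + `|b - w|.
      by rewrite (le_trans _ (ler_normD _ _))// addrA subrK.
    have h4 := supnorm_le_cmod (b - w); rewrite cmodC wb -/d in h4.
    have h5 := cmod_le_supnorm (f x - w).
    by move: tt2; rewrite /t2; lra.
  have [|tau] := IVT ler01 phic (v := t).
    by rewrite ge_min phi0 le_max phi1 orbT.
  rewrite in_itv/= => t01 phit.
  pose C : set (R * R) := [set z | `|z - m| <= 2 * a].
  have cC : compact C.
    have -> : C = `[m.1 - 2 * a, m.1 + 2 * a]%classic `*` `[m.2 - 2 * a, m.2 + 2 * a]%classic.
      apply/seteqP; split => z; rewrite /C /= supnormE ge_max /= !ler_norml !in_itv/=.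
        by move=> /andP[h1 h2]; lra.
      by move=> [h1 h2]; lra.
    by apply: compact_setX; exact: segment_compact.
  have Ds : D (sigma tau) by apply: inD1; exact: sm.
  have [Dfs gfs] := fP _ Ds.
  have Cs : C (g (f (sigma tau))).
    by rewrite gfs /C/= (le_trans (sm _ t01))//; lra.
  have [v [s [l [[s1 l0 v8 vl8] [ve vD vout]]]]] :=
    square_arc_leaving fP gP fc cC inD Dfs Cs b1 t0 phit.
  apply: (cross_energy_ge mh h0 t0 s1 l0 v8 vl8).
  have cD := square_arc_in l0 vD.
  have fg : f \o (g \o square_arc b t v s l) = square_arc b t v s l.
    by apply/funext => u /=; rewrite (gP _ (cD u)).2.
  apply: hadm; last first.
    by rewrite /rectifiable square_arc_length ?ltry// ler01 lexx.
  rewrite -[X in _ X]fg; exists (g \o square_arc b t v s l) => //; split.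
  - split; last by move=> _ [u _ <-] /=; apply: (gP _ _).1.
    apply: continuous_subspaceT => u.
    by apply: continuous_comp; [exact: square_arc_continuous|apply: gc].
  - exists tau => //=; rewrite square_arcE ?lexx ?ler01// !mulr0 addr0 ve.
    by rewrite gfs.
  - rewrite /= square_arcE ?lexx ?ler01// mulr1 ltW// ltNge; apply/negP => h1.
    exact: vout.
have := le_trans low up; rewrite lee_fin.
have : ln (e * t1) <= ln t2 by rewrite ler_ln ?posrE ?mulr_gt0 ?expR_gt0// ltW.
rewrite lnM ?posrE ?expR_gt0// expRK; lra.
Qed.

End LocalDistortion.

Section Distortion.
Context {R : realType}.
Local Notation D := (@unit_disk R).

(** Along the chain [1 - cmod (w i)] grows at most by the factor [1 + M] at each step,
    so the steps are dominated by a geometric progression. *)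
Lemma chain_distortion (w : nat -> R * R) (M : R) (n : nat) : 0 <= M ->
  (forall i, (i < n)%N -> cmod (w i - w i.+1) <= M * (1 - cmod (w i))) ->
  cmod (w 0%N - w n) <= ((1 + M) ^+ n - 1) * (1 - cmod (w 0%N)).
Proof.
move=> M0; elim: n => [_|n ih hw]; first by rewrite !subrr cmod0 mul0r.
have {}ih := ih (fun i i_n => hw i (ltnW i_n)).
have step := hw n (ltnSn n).
have h0 := cmod_dist_dist (w 0%N) (w n).
have h1 : 1 - cmod (w n) <= (1 + M) ^+ n * (1 - cmod (w 0%N)).
  by move: h0; rewrite ler_norml => /andP[_]; lra.
apply: le_trans (cmod_dist_triangle _ (w n) _) _; rewrite exprS.
have := ler_wpM2l M0 h1; lra.
Qed.

Lemma one_sub_cmod_segment (p z : R * R) (d tau : R) : 0 <= tau <= 1 ->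
  d <= 1 - cmod p -> d <= 1 - cmod z -> d <= 1 - cmod (p + tau *: (z - p)).
Proof.
move=> /andP[t0 t1] pd zd.
have -> : p + tau *: (z - p) = (1 - tau) *: p + tau *: z.
  by rewrite scalerBl scale1r scalerBr addrA addrAC.
have := cmod_triangle ((1 - tau) *: p) (tau *: z).
rewrite !cmodZ !ger0_norm ?subr_ge0//; nra.
Qed.

(** Points at bounded hyperbolic distance are joined by boundedly many steps that
    are short compared with the distance to the unit circle. *)
Lemma qc_distortion (f : R * R -> R * R) (K c : R) (n : nat) (p z : R * R) :
  self_homeomorphism D f -> 1 <= K -> K_quasiconformal D K f ->
  D p -> D z -> (0 < n)%N -> 5 * c <= n%:R ->
  cmod (p - z) <= c * (1 - cmod p) -> cmod (p - z) <= c * (1 - cmod z) ->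
  cmod (f p - f z) <= (1 + distortion K) ^+ n * (1 - cmod (f p)).
Proof.
move=> hf K1 hK Dp Dz n0 cn cp cz.
have n0' : 0 < n%:R :> R by rewrite ltr0n.
have n0'' : n%:R != 0 :> R by rewrite gt_eqF.
have M0 := distortion_ge0 K.
pose sigma (i : nat) := p + (i%:R / n%:R) *: (z - p).
pose d := Num.min (1 - cmod p) (1 - cmod z).
have d0 : 0 < d by rewrite lt_min !subr_gt0 Dp.
have dp : d <= 1 - cmod p by rewrite ge_min lexx.
have dz : d <= 1 - cmod z by rewrite ge_min lexx orbT.
have cd : cmod (p - z) <= c * d by rewrite /d /Num.min; case: ifP.
have sd i : (i <= n)%N -> d <= 1 - cmod (sigma i).
  move=> i_n; apply: one_sub_cmod_segment => //.
  by rewrite divr_ge0//= ler_pdivrMr// mul1r ler_nat.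
have step i : `|sigma i.+1 - sigma i| <= d / 5.
  apply: le_trans (supnorm_le_cmod _) _.
  rewrite /sigma opprD addrACA subrr add0r -scalerBl cmodZ -mulrBl -natrB// subSnn.
  have ni : 0 <= 1 / n%:R :> R by rewrite divr_ge0// ltW.
  by rewrite (ger0_norm ni) cmodC mulrC mul1r ler_pdivrMr//; nra.
pose w i := f (sigma i).
have hw i : (i < n)%N -> cmod (w i - w i.+1) <= distortion K * (1 - cmod (w i)).
  move=> i_n; have di := sd i (ltnW i_n).
  rewrite cmodC; apply: (qc_local_distortion (m := sigma i)) => //.
  - by rewrite /unit_disk/=; lra.
  - by apply: le_trans (step i) _; lra.
  - by rewrite subrr normr0; lra.
have := chain_distortion M0 hw.
rewrite /w /sigma mul0r scale0r addr0 divff// scale1r subrKC => h.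
apply: le_trans h _; have : 0 <= 1 - cmod (f p).
  have [g [fP _ _ _]] := self_homeomorphism_inverse hf.
  by have [fD _] := fP _ Dp; rewrite subr_ge0 ltW.
nra.
Qed.

Lemma self_homeomorphism_subdomain (f : R * R -> R * R) (X : set (R * R)) :
  self_homeomorphism D f -> subdomain X -> subdomain (f @` X).
Proof.
move=> hf [[x0 Xx0] oX cX XD].
have [g [fP gP fc gc]] := self_homeomorphism_inverse hf; split.
- by exists (f x0), x0.
- rewrite openE => _ [x Xx <-].
  have [Dfx gfx] := fP _ (XD _ Xx).
  have gX : nbhs (f x) (g @^-1` X).
    by apply: (gc _ Dfx); rewrite gfx; apply: open_nbhs_nbhs.
  have nD : nbhs (f x) D by apply: open_nbhs_nbhs; split=> //; exact: open_unit_disk.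
  apply: filterS2 gX nD => y gyX Dy; exists (g y) => //.
  by rewrite (gP _ Dy).2.
- apply: connected_continuous_connected => //.
  apply: continuous_in_subspaceT => x /set_mem /XD; exact: fc.
- by move=> _ [x /XD Dx <-]; exact: (fP _ Dx).1.
Qed.

End Distortion.

(** * Bloch subdomains *)

Theorem theorem1p4 (R : realType) (f : R * R -> R * R)
    (hf : qc_self_homeomorphism f) (X : set (R * R)) :
  bloch_subdomain X -> bloch_subdomain (f @` X)%classic.
Proof.
move=> [sX bX]; case: hf => hf [K K1 hK].
split; first exact: self_homeomorphism_subdomain.
have [g [fP gP _ _]] := self_homeomorphism_inverse hf.
have [s s0 Xs] : exists2 s : R, 0 < s & (bloch_radius X < s%:E)%E.
  case: (bloch_radius X) bX => [r _|//|_]; last by exists 1 => //; exact: ltNyr.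
  exists (`|r| + 1); first by rewrite ltr_wpDl.
  by rewrite lte_fin (le_lt_trans (ler_norm r))// ltrDl.
(* the constant of [poincare_dist_lt_cmod] for the radius [s] *)
pose c := expR (2 * s).
have [n n0 cn] : exists2 n, (0 < n)%N & 5 * c <= n%:R.
  by exists (Num.truncn (5 * c)).+1 => //; exact/ltW/truncnS_gt.
pose B := (1 + distortion K) ^+ n.
apply: (@le_lt_trans _ _ B%:E); last exact: ltry.
apply: ge_ereal_sup => _ [r [r0 [q Dq qX]] <-].
rewrite lee_fin leNgt; apply/negP => Br.
have [Dgq fgq] := gP _ Dq.
suff : (s%:E <= bloch_radius X)%E by rewrite leNgt Xs.
apply: ereal_sup_ubound; exists s => //; split=> //; exists (g q) => // z [Dz zs].
have [h1 h2] := poincare_dist_lt_cmod zs.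
have [Dfz gfz] := fP _ Dz.
suff /qX [x Xx fxz] : hyperbolic_disk q r (f z).
  have [_ gfx] := fP _ (let: And4 _ _ _ XD := sX in XD _ Xx).
  by rewrite -gfz -fxz gfx.
split=> //; apply: le_lt_trans (_ : (B%:E < r%:E)%E); last by rewrite lte_fin.
pose d := Num.min (1 - cmod (f z)) (1 - cmod q).
have d0 : 0 < d by rewrite lt_min !subr_gt0 Dfz.
have dz : d <= 1 - cmod (f z) by rewrite ge_min lexx.
have dq : d <= 1 - cmod q by rewrite ge_min lexx orbT.
have k1 := qc_distortion hf K1 hK Dz Dgq n0 cn h1 h2.
have k2 := qc_distortion hf K1 hK Dgq Dz n0 cn.
rewrite cmodC in h1; rewrite cmodC in h2; have {}k2 := k2 h2 h1.
rewrite fgq in k1 k2; rewrite cmodC in k2.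
apply: le_trans (poincare_dist_le_segment d0 _ _) _; [lra..|].
rewrite lee_fin ler_pdivrMr// /d /Num.min.
by case: ifP.
Qed.
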